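(* Let $(X,d)$ be a complete metric space. For every parameter $\eta\in[0,1]$ let $\mathcal{R}_\eta\subset C(\mathbb{R}_+;X)$ satisfy (K1), (K2), (K3) and (K4), and let $G_\eta$ be the corresponding m-semiflow on $X$, assumed to have a compact global attractor $\mathcal{A}_\eta$. Assume that: (H1) $\overline{\bigcup_{\eta\in[0,1]}\mathcal{A}_\eta}$ is compact. (H2) $G_0$ is dynamically gradient with respect to a finite family of isolated weakly invariant sets $\mathcal{S}^0=\{\Xi_1^0,\ldots,\Xi_n^0\}$. (H3) For each $\eta\in[0,1]$, $\mathcal{A}_\eta$ has a finite family of isolated weakly invariant sets $\mathcal{S}_\eta=\{\Xi_1^\eta,\ldots,\Xi_n^\eta\}$ (equal to $\mathcal{S}^0$ for $\eta=0$), and $$\lim_{\eta\to 0}\ \sup_{1\le i\le n} dist_X(\Xi_i^\eta,\Xi_i^0)=0.$$ (H4) Any sequence $\{\gamma_\eta\}$ (with $\eta\to0$) such that $\gamma_\eta\in\mathcal{R}_\eta$ and $\{\gamma_\eta(0)\}$ converges has a subsequence that converges, uniformly on bounded intervals of $[0,\infty)$, to some $\gamma\in\mathcal{R}_0$. (H5) There exist $\overline{\eta}>0$ and neighborhoods $V_i$ of $\Xi_i^0$ such that, for every $i=1,\ldots,n$ and every $0<\eta\le\overline{\eta}$, $\Xi_i^\eta$ is the maximal weakly invariant set for $G_\eta$ in $V_i$. Then there exists $\eta_0>0$ such that for all $\eta\le\eta_0$ the m-semiflow $G_\eta$ is dynamically gradient with respect to $\mathcal{S}_\eta$. In particular, for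 such $\eta$, $$\mathcal{A}_\eta=\{\gamma(0):\gamma\in\mathbb{K}_\eta\}=\bigcup_{t\in\mathbb{R}}\{\gamma(t):\gamma\in\mathbb{K}_\eta\},$$ where $\mathbb{K}_\eta$ is the set of all bounded complete trajectories of $\mathcal{R}_\eta$.
   Context: Let $(X,d)$ be a metric space, $P(X)$ the class of nonempty subsets of $X$, and $dist_X(A,B)=\sup_{a\in A}\inf_{b\in B}d(a,b)$; for a point $x$, $dist_X(x,B)=dist_X(\{x\},B)$. For a family $\mathcal{R}\subset C(\mathbb{R}_+;X)$ consider the properties: (K1) For any $x\in X$ there is $\varphi\in\mathcal{R}$ with $\varphi(0)=x$. (K2) $\varphi(\cdot+\tau)\in\mathcal{R}$ for all $\tau\ge0$, $\varphi\in\mathcal{R}$. (K3) If $\varphi_1,\varphi_2\in\mathcal{R}$ and $\varphi_2(0)=\varphi_1(s)$ for some $s>0$, then the function equal to $\varphi_1(t)$ for $0\le t\le s$ and to $\varphi_2(t-s)$ for $t\ge s$ belongs to $\mathcal{R}$. (K4) For any sequence $\{\varphi^n\}\subset\mathcal{R}$ with $\varphi^n(0)\to x_0$ in $X$ there are a subsequence $\{\varphi^{n_k}\}$ and $\varphi\in\mathcal{R}$ with $\varphi^{n_k}(t)\to\varphi(t)$ for all $t\ge0$. The associated multivalued map is $G(t,x)=\{u(t):u\in\mathcal{R},\,u(0)=x\}$, $G:\mathbb{R}_+\times X\to P(X)$. It is a multivalued semiflow (m-semiflow): $G(0,x)=x$ and $G(t+s,x)\subset G(t,G(s,x))$ for all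 $t,s\ge0$, $x\in X$. A complete trajectory of $\mathcal{R}$ is a map $\gamma:\mathbb{R}\to X$ such that $\gamma(\cdot+h)|_{[0,\infty)}\in\mathcal{R}$ for all $h\in\mathbb{R}$. A set $B\subset X$ is weakly invariant if for every $x\in B$ there is a complete trajectory $\gamma$ of $\mathcal{R}$ contained in $B$ with $\gamma(0)=x$ (weakly invariant ''for $G_\eta$'' refers to complete trajectories of $\mathcal{R}_\eta$). A set $\mathcal{A}\subset X$ is a global attractor for $G$ if $\mathcal{A}\subset G(t,\mathcal{A})$ for all $t\ge0$ and $dist_X(G(t,B),\mathcal{A})\to0$ as $t\to\infty$ for every bounded $B\subset X$. Isolated family: $\mathcal{S}=\{\Xi_1,\ldots,\Xi_n\}$ is a family of isolated weakly invariant sets if there is $\delta>0$ such that, with $\mathcal{O}_\delta(\Xi_i)=\{x\in X: dist_X(x,\Xi_i)<\delta\}$, one has $\mathcal{O}_\delta(\Xi_i)\cap\mathcal{O}_\delta(\Xi_j)=\emptyset$ for $i<j$, and each $\Xi_i$ is the maximal weakly invariant subset of $\mathcal{O}_\delta(\Xi_i)$. Homoclinic orbit: given $G$ with global attractor $\mathcal{A}$ and a finite family $\mathcal{S}$ of weakly invariant sets, a homoclinic orbit in $\mathcal{A}$ is a collection $\{\Xi_{p(1)},\ldots,\Xi_{p(k)}\}\subset\mathcal{S}$ together with complete trajectories $\gamma_1,\dots,\gamma_k$ of $\mathcal{R}$ in $\mathcal{A}$ such that (with $p(k+1):=p(1)$) $\lim_{t\to-\infty}dist_X(\gamma_i(t),\Xi_{p(i)})=0$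 and $\lim_{t\to\infty}dist_X(\gamma_i(t),\Xi_{p(i+1)})=0$ for $1\le i\le k$, and for each $i$ there is $t_i\in\mathbb{R}$ with $\gamma_i(t_i)\notin\Xi_{p(i)}\cup\Xi_{p(i+1)}$. Dynamically gradient: $G$ with global attractor $\mathcal{A}$ is dynamically gradient with respect to a finite family $\mathcal{S}=\{\Xi_1,\ldots,\Xi_n\}$ of isolated weakly invariant sets in $\mathcal{A}$ if (G1) every complete trajectory $\gamma$ of $\mathcal{R}$ in $\mathcal{A}$ satisfies $\lim_{t\to-\infty}dist_X(\gamma(t),\Xi_i)=0$ and $\lim_{t\to\infty}dist_X(\gamma(t),\Xi_j)=0$ for some $1\le i,j\le n$; and (G2) $\mathcal{S}$ does not contain homoclinic orbits. *)

(* Defs.v *)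
From HB Require Import structures.
From mathcomp Require Import all_boot all_order all_algebra.
From mathcomp Require Import all_classical all_reals all_analysis.

Set Implicit Arguments.
Unset Strict Implicit.
Unset Printing Implicit Defensive.

Import Order.TTheory GRing.Theory Num.Theory.
Import numFieldNormedType.Exports.

Local Open Scope classical_set_scope.
Local Open Scope ring_scope.

#[short(type="completeMetricType")]
HB.structure Definition CompleteMetric (R : numDomainType) :=
  {T of Complete T & Metric R T}.

Section Semiflows.
Context {R : realType} {X : metricType R}.

(* The half-line of times is the type {nonneg R}; a trajectory is an honest
   function on it, so that equality of trajectories is equality on [0, oo). *)
Definition trajectory := {nonneg R} -> X.

(* {nonneg R} carries no topology in the library; the one used here is induced
   by the inclusion in R. *)
Definition trajectory_continuous (phi : trajectory) : Prop :=
  continuous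
    (phi : initial_topology (fun t : {nonneg R} => t%:num : R) -> X).

Definition nonneg_pinfty : set_system {nonneg R} :=
  [set P | exists M : R, forall t : {nonneg R}, M < t%:num -> P t].

(* The values are extended reals. The intended arguments are nonempty: the
   empty set gives sup = -oo on the left and inf = +oo on the right. *)
Definition distX (A B : set X) : \bar R :=
  ereal_sup [set ereal_inf [set (mdist a b)%:E | b in B] | a in A].

Definition metric_bounded (B : set X) : Prop :=
  exists M : R, forall x y, B x -> B y -> mdist x y <= M.

Definition K1 (F : set trajectory) : Prop :=
  forall x : X, exists2 phi, F phi & phi 0%:nng = x.

Definition K2 (F : set trajectory) : Prop :=
  forall (tau : {nonneg R}) (phi : trajectory), F phi ->
    F (fun t => phi (t%:num + tau%:num)%:nng).

(* The two conditions on phi determine it: it is phi1 up to time s, followed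
   by phi2. *)
Definition K3 (F : set trajectory) : Prop :=
  forall (phi1 phi2 : trajectory) (s : {nonneg R}),
    F phi1 -> F phi2 -> 0 < s%:num -> phi2 0%:nng = phi1 s ->
  forall phi : trajectory,
    (forall t : {nonneg R}, t%:num <= s%:num -> phi t = phi1 t) ->
    (forall t : {nonneg R}, phi (s%:num + t%:num)%:nng = phi2 t) ->
  F phi.

Definition K4 (F : set trajectory) : Prop :=
  forall (phi : nat -> trajectory) (x0 : X),
    (forall k, F (phi k)) -> phi k 0%:nng @[k --> \oo] --> x0 ->
  exists (sigma : nat -> nat) (psi : trajectory),
    [/\ increasing_seq sigma, F psi
      & forall t : {nonneg R}, phi (sigma k) t @[k --> \oo] --> psi t].

(* G t x is the value at (t, x) of the multivalued semiflow of the family F. *)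
Definition G (F : set trajectory) (t : {nonneg R}) (x : X) : set X :=
  [set u t | u in [set u | F u /\ u 0%:nng = x]].

Definition Gset (F : set trajectory) (t : {nonneg R}) (B : set X) : set X :=
  \bigcup_(x in B) G F t x.

Definition complete_trajectory (F : set trajectory) (gamma : R -> X) : Prop :=
  forall h : R, F (fun t : {nonneg R} => gamma (t%:num + h)).

Definition bounded_complete_trajectories (F : set trajectory) : set (R -> X) :=
  [set gamma | complete_trajectory F gamma /\ metric_bounded (range gamma)].

Definition weakly_invariant (F : set trajectory) (B : set X) : Prop :=
  forall x, B x -> exists gamma : R -> X,
    [/\ complete_trajectory F gamma, (forall t, B (gamma t)) & gamma 0 = x].

Definition maximal_weakly_invariant
    (F : set trajectory) (O Xi : set X) : Prop :=
  [/\ weakly_invariant F Xi, Xi `<=` O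
    & forall B, weakly_invariant F B -> B `<=` O -> B `<=` Xi].

Definition global_attractor (F : set trajectory) (A : set X) : Prop :=
  (forall t : {nonneg R}, A `<=` Gset F t A) /\
  (forall B : set X, B !=set0 -> metric_bounded B ->
    distX (Gset F t B) A @[t --> nonneg_pinfty] --> 0%E).

Definition thickening (delta : R) (Xi : set X) : set X :=
  [set x | (distX [set x] Xi < delta%:E)%E].

Definition isolated_family (F : set trajectory) (n : nat)
    (Xi : 'I_n -> set X) : Prop :=
  (forall i, Xi i !=set0) /\
  exists2 delta : R, 0 < delta &
    (forall i j : 'I_n, (i < j)%N ->
       thickening delta (Xi i) `&` thickening delta (Xi j) = set0) /\
    (forall i, maximal_weakly_invariant F (thickening delta (Xi i)) (Xi i)).

Definition isolated_family_in (F : set trajectory) (A : set X) (n : nat)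
    (Xi : 'I_n -> set X) : Prop :=
  isolated_family F Xi /\ (forall i, Xi i `<=` A).

(* The cycle has length k + 1 >= 1, and ordS is the cyclic successor. *)
Definition homoclinic_orbit (F : set trajectory) (A : set X) (n : nat)
    (Xi : 'I_n -> set X) (k : nat) (p : 'I_k.+1 -> 'I_n)
    (gamma : 'I_k.+1 -> R -> X) : Prop :=
  forall i : 'I_k.+1,
    [/\ complete_trajectory F (gamma i),
        (forall t, A (gamma i t)),
        distX [set gamma i t] (Xi (p i)) @[t --> -oo] --> 0%E,
        distX [set gamma i t] (Xi (p (ordS i))) @[t --> +oo] --> 0%E
      & exists t, ~ (Xi (p i) `|` Xi (p (ordS i))) (gamma i t)].

Definition dynamically_gradient (F : set trajectory) (A : set X) (n : nat)
    (Xi : 'I_n -> set X) : Prop :=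
  [/\ isolated_family_in F A Xi,
      (forall gamma : R -> X,
         complete_trajectory F gamma -> (forall t, A (gamma t)) ->
         exists i j : 'I_n,
           distX [set gamma t] (Xi i) @[t --> -oo] --> 0%E /\
           distX [set gamma t] (Xi j) @[t --> +oo] --> 0%E)
    & ~ (exists k (p : 'I_k.+1 -> 'I_n) (gamma : 'I_k.+1 -> R -> X),
           homoclinic_orbit F A Xi p gamma)].

End Semiflows.

Arguments trajectory {R} X.
Arguments G {R X}.

(* Main.v *)
Require Import Defs.
From HB Require Import structures.
From mathcomp Require Import all_boot all_order all_algebra.
From mathcomp Require Import all_classical all_reals all_analysis.
From mathcomp Require Import lra.

(**
The point of the argument is that an orbit of [F eta] which misbehaves for
arbitrarily small [eta] leaves, in the limit [eta -> 0], a trace of connections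
between the sets [Xi 0 i] inside [A 0], and that such a trace can be continued
for ever.  There are only [n] sets, so an endless trace closes up into a cycle
of connections, that is, a homoclinic orbit of the limit, which [H2] excludes.

One step of the trace is [connection_step].  Let [gamma_k] be complete
trajectories of [F eta_k], [eta_k -> 0], which come closer and closer to
[Xi 0 i] and afterwards leave its [r]-neighbourhood.  Recentre each of them at
the first exit time and pass to a limit [zeta], a complete trajectory in [A 0].
If the time spent near [Xi 0 i] before the exit is unbounded, then [zeta] stays
near [Xi 0 i] for all negative times.  If it is bounded, then [zeta] starts at
a point of [Xi 0 i], and its past can be replaced by a trajectory inside the
weakly invariant set [Xi 0 i], by concatenation.  In both cases the gradient
structure of the limit makes the result a connection from [Xi 0 i] to some
[Xi 0 j], and the [gamma_k] come close to [Xi 0 j] after their exit.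

[no_bad_trajectory] iterates this step for a class of bad trajectories in which
every visit to some [Xi 0 j] can be prolonged to a visit followed by an exit.
It is used three times:
- for trajectories that keep leaving each [r]-neighbourhood as time grows;
- for the same trajectories with time reversed, the hypotheses collected in
  [limit_system] being invariant under time reversal;
- for the members of homoclinic orbits of [F eta], where a trajectory that
  settles near [Xi 0 j] is continued by the next one of the cycle, which issues
  from [Xi eta j]; this uses that [Xi eta j] is close to [Xi 0 j].

So for small [eta] there are no homoclinic orbits, and each complete trajectory
in [A eta] finally remains near one set [Xi 0 j], in both time directions.  Its
limit points then lie on complete trajectories contained in the neighbourhood
[V j], hence in [Xi eta j] by the maximality in [H5]; this gives the convergence
to [Xi eta j] ([eventually_near_approaches]).

All limits of complete trajectories come from [limit_complete], a diagonal
extraction over the half-lines [[-N, +oo)].  The description of [A eta] by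
bounded complete trajectories uses that (K3) makes the attractor invariant, so
that trajectories inside it can be chained backwards ([attractor_complete]).
*)

Set Implicit Arguments.
Unset Strict Implicit.
Unset Printing Implicit Defensive.

Import Order.TTheory GRing.Theory Num.Theory.
Import numFieldNormedType.Exports.

Local Open Scope classical_set_scope.
Local Open Scope ring_scope.

(** * Neighbourhoods and sequences in a metric space *)

Section Neighbourhoods.
Context {R : realType} {X : metricType R}.
Implicit Types (A B : set X) (x y : X) (e : R).

(** Working with this open neighbourhood instead of the distance to [A] avoids
infima; it coincides with [thickening] by [thickeningE]. *)
Definition nhd e A : set X := [set x | exists2 a, A a & mdist x a < e].

Lemma nhd_le e e' A : e <= e' -> nhd e A `<=` nhd e' A.
Proof. by move=> le x [a Aa xa]; exists a => //; exact: lt_le_trans le. Qed.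

Lemma nhd_subset e A B : A `<=` B -> nhd e A `<=` nhd e B.
Proof. by move=> AB x [a /AB Ba xa]; exists a. Qed.

Lemma nhd_near e e' A x y : nhd e A x -> mdist x y < e' -> nhd (e + e') A y.
Proof.
move=> [a Aa xa] xy; exists a => //; rewrite addrC.
by rewrite (le_lt_trans (metric_triangle _ x _))// metric_sym ltrD.
Qed.

Lemma nhd_nhd e e' A : nhd e (nhd e' A) `<=` nhd (e + e') A.
Proof.
move=> x [y Ay xy]; rewrite addrC; apply: nhd_near Ay _; by rewrite metric_sym.
Qed.

Lemma nhd_self e A : 0 < e -> A `<=` nhd e A.
Proof. by move=> e0 x Ax; exists x => //; rewrite mdistxx. Qed.

Lemma open_nhd e A : open (nhd e A).
Proof.
rewrite openE => x [a Aa xa]; rewrite /interior -metricType_numDomainType.filter_from_mdist_nbhs.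
exists (e - mdist x a) => /=; first by rewrite subr_gt0.
move=> y /= xy; exists a => //.
by rewrite (le_lt_trans (metric_triangle _ x _))// metric_sym -ltrBrDr.
Qed.

Lemma distX_lt A B e : (distX A B < e%:E)%E -> A `<=` nhd e B.
Proof.
move=> AB x Ax.
have : (ereal_inf [set (mdist x b)%:E | b in B] < e%:E)%E.
  by apply: le_lt_trans AB; apply: ereal_sup_ubound; exists x.
by move=> /ereal_inf_lt[_ [b Bb <-]]; rewrite lte_fin => xb; exists b.
Qed.

Lemma distX_set1_ltE x B e : (distX [set x] B < e%:E)%E <-> nhd e B x.
Proof.
split=> [/distX_lt|[b Bb xb]]; first exact.
rewrite /distX image_set1 ereal_sup1 (@le_lt_trans _ _ (mdist x b)%:E)//.
by apply: ereal_inf_lbound; exists b.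
Qed.

Lemma distX_set1_ge0 x B : (0 <= distX [set x] B)%E.
Proof.
rewrite /distX image_set1 ereal_sup1; apply: le_ereal_inf_tmp => _ [b _ <-].
by rewrite lee_fin mdist_ge0.
Qed.

Lemma thickeningE e A : thickening e A = nhd e A.
Proof. by apply/seteqP; split=> x /distX_set1_ltE. Qed.

Lemma cvge0_near_lt {T} (F : set_system T) (u : T -> \bar R) e :
  Filter F -> u t @[t --> F] --> 0%E -> 0 < e ->
  \forall t \near F, (u t < e%:E)%E.
Proof.
move=> FF u0 e0; apply: (u0 [set z | (z < e%:E)%E]).
by apply: open_ereal_lt'; rewrite lte_fin.
Qed.

Lemma cvg_distXP {T} (F : set_system T) (f : T -> X) A : Filter F ->
  distX [set f t] A @[t --> F] --> 0%E <->
  forall e, 0 < e -> \forall t \near F, nhd e A (f t).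
Proof.
move=> FF; split=> [h e e0|h].
  by have := cvge0_near_lt FF h e0; apply: filterS => t /distX_set1_ltE.
move=> P /= [e /= e0 eP]; rewrite /nbhs/=.
have := h e e0; apply: filterS => t /distX_set1_ltE; move: (distX_set1_ge0 (f t) A).
rewrite /preimage/=; case: (distX _ _) => [r| |]//; rewrite lee_fin lte_fin => r0 re.
by apply: eP => /=; rewrite sub0r normrN ger0_norm.
Qed.

Lemma near_pinftyP (P : R -> Prop) :
  (\forall t \near +oo, P t) <-> exists M, forall t, M < t -> P t.
Proof.
split=> [[M [_ h]]|[M h]]; first by exists M.
by exists M; split=> //; exact: num_real.
Qed.

Definition approaches (gamma : R -> X) A :=
  forall e, 0 < e -> exists M, forall t, M < t -> nhd e A (gamma t).

Lemma cvg_pinfty_approaches (gamma : R -> X) A :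
  distX [set gamma t] A @[t --> +oo] --> 0%E <-> approaches gamma A.
Proof.
rewrite cvg_distXP; split=> h e e0; first exact/near_pinftyP/h.
exact/near_pinftyP/h.
Qed.

Lemma cvg_ninfty_approaches (gamma : R -> X) A :
  distX [set gamma t] A @[t --> -oo] --> 0%E <->
  approaches (fun t => gamma (- t)) A.
Proof.
rewrite cvg_distXP; split=> h e e0.
  have [M [_ hM]] := h e e0; exists (- M) => t Mt; apply: hM.
  by rewrite ltrNl.
have [M hM] := h e e0; exists (- M); split; first exact: num_real.
by move=> t tM; rewrite -(opprK t); apply: hM; rewrite ltrNr.
Qed.

Definition seq_lim (u : nat -> X) x :=
  forall e, 0 < e -> exists N, forall k, (N <= k)%N -> mdist (u k) x < e.

Lemma seq_limP (u : nat -> X) x : u k @[k --> \oo] --> x <-> seq_lim u x.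
Proof.
rewrite metricType_numDomainType.cvgrPdist_lt; split=> h e e0.
  have [N _ hN] := h e e0; exists N => k Nk; rewrite metric_sym; exact: hN.
by have [N hN] := h e e0; exists N => // k /= Nk; rewrite metric_sym; exact: hN.
Qed.

Lemma seq_lim_unique (u : nat -> X) x y : seq_lim u x -> seq_lim u y -> x = y.
Proof.
move=> /seq_limP ux /seq_limP uy; apply: (cvg_unique _ ux uy).
exact: metric_hausdorff.
Qed.

Lemma compact_seq (K : set X) (u : nat -> X) : compact K -> (forall k, K (u k)) ->
  exists x (s : nat -> nat), [/\ K x, forall k, (k <= s k)%N & seq_lim (u \o s) x].
Proof.
move=> cK Ku.
have [|x [Kx xu]] := cK (u @ \oo) _; first by exists 0%N => // k _ /=; exact: Ku.
have /choice[s hs] : forall k, exists m, (k <= m)%N /\ mdist (u m) x < k.+1%:R^-1.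
  move=> k; have [||y [[m /= km <-] xy]] := xu (u @` [set m | (k <= m)%N]) (ball x k.+1%:R^-1).
  - by exists k => // m /= km; exists m.
  - by apply: nbhsx_ballx; rewrite invr_gt0.
  by exists m; split=> //; move: xy; rewrite ballEmdist/= metric_sym.
exists x, s; split=> // [k|e e0]; first by case: (hs k).
have [N _ hN] := @near_infty_natSinv_lt R (PosNum e0).
exists N => k Nk; have [_ /lt_trans] := hs k; apply; exact: hN.
Qed.

Lemma compact_seq_lim (K : set X) (u : nat -> X) x : compact K -> 
  (forall k, K (u k)) -> seq_lim u x -> K x.
Proof.
move=> cK Ku ux; have [y [s [Ky ks uy]]] := compact_seq cK Ku.
suff -> : x = y by [].
apply: seq_lim_unique uy => e e0; have [N hN] := ux e e0.
by exists N => k Nk; apply: hN; apply: leq_trans (ks k).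
Qed.

Lemma nhd_seq_lim e e' A (u : nat -> X) x : e < e' ->
  (forall N, exists2 k, (N <= k)%N & nhd e A (u k)) -> seq_lim u x ->
  nhd e' A x.
Proof.
move=> ee' uA ux; have e0 : 0 < e' - e by rewrite subr_gt0.
have [N hN] := ux _ e0; have [k Nk Auk] := uA N.
by rewrite -(subrKC e e'); apply: nhd_near Auk (hN k Nk).
Qed.

(** The exit time is the infimum of the times spent outside [U]; since [U] is
open, the trajectory is already outside at that time. *)
Lemma first_exit (gamma : R -> X) (U : set X) s t1 :
  continuous gamma -> open U -> s <= t1 -> ~ U (gamma t1) ->
  exists tau, [/\ s <= tau <= t1, ~ U (gamma tau)
    & forall t, s <= t < tau -> U (gamma t)].
Proof.
move=> cg oU st1 nU; pose S := [set t | s <= t <= t1 /\ ~ U (gamma t)].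
have St1 : S t1 by split=> //; rewrite st1 lexx.
have lS : lbound S s by move=> t [/andP[]].
have hS : has_inf S by split; [exists t1|exists s].
have stau : s <= inf S by apply: lb_le_inf lS; exists t1.
have taut : inf S <= t1 by apply: ge_inf => //; exists s.
exists (inf S); split; first by rewrite stau.
- move=> Utau; have /nbhs_ballP[d /= d0 hd] : nbhs (inf S) (gamma @^-1` U).
    by apply: cg; exact: open_nbhs_nbhs.
  have [t [tS nUt] ti] := inf_adherent d0 hS.
  have it : inf S <= t by apply: ge_inf; [exists s|split].
  apply: nUt; apply: hd; rewrite /ball/=.
  by rewrite distrC ger0_norm ?subr_ge0// ltrBlDl.
- move=> t /andP[st ti]; apply: contrapT => nUt.
  suff : inf S <= t by rewrite leNgt ti.
  apply: ge_inf; first by exists s.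
  by split=> //; rewrite st ltW// (lt_le_trans ti).
Qed.

End Neighbourhoods.

(** diagonal *)
(** Only [k <= r k] is asked of a reindexing [r], not monotonicity: this is
enough for limits along [r] and is trivially stable under composition.  The
second hypothesis says that [P N] survives passing to a sequence which, from
rank [N] on, is drawn from the tails of the given one; the diagonal is such a
sequence for each of the nested extractions. *)
Lemma diagonal_subsequence (P : nat -> (nat -> nat) -> Prop) :
  (forall N r, (forall k, (k <= r k)%N) ->
    exists2 s, (forall k, (k <= s k)%N) & P N (r \o s)) ->
  (forall N r r', P N r ->
    (forall k, (N <= k)%N -> exists2 j, (k <= j)%N & r' k = r j) -> P N r') ->
  exists2 r, (forall k, (k <= r k)%N) & forall N, P N r.
Proof.
move=> extract tail.
have /choice[nxt hnxt] : forall Nr : nat * (nat -> nat), exists s,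
    (forall k, (k <= Nr.2 k)%N) -> (forall k, (k <= s k)%N) /\ P Nr.1 (Nr.2 \o s).
  move=> [N r] /=; have [hr|hr] := pselect (forall k, (k <= r k)%N).
    by have [s s1 s2] := extract N r hr; exists s.
  by exists id.
pose fix S N := if N is M.+1 then S M \o nxt (N, S M) else id \o nxt (0%N, id).
have hS N : (forall k, (k <= S N k)%N) /\ P N (S N).
  elim: N => [|N [IH1 IH2]].
    have [|h1 h2] := hnxt (0%N, id); first by move=> k /=.
    by split=> // k; exact: h1.
  have [|h1 h2] := hnxt (N.+1, S N); first exact: IH1.
  by split=> // k /=; exact: leq_trans (IH1 _).
have sub N m k : exists2 j, (k <= j)%N & S (m + N)%N k = S N j.
  elim: m k => [|m IH] k; first by exists k.
  have [h1 _] := hnxt ((m + N).+1, S (m + N)%N) (hS _).1.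
  have [j kj e] := IH (nxt ((m + N).+1, S (m + N)%N) k).
  by exists j => //; apply: leq_trans kj; exact: h1.
exists (fun k => S k k); first by move=> k; exact: (hS k).1.
move=> N; apply: tail (hS N).2 _ => k Nk.
by have [j kj e] := sub N (k - N)%N k; exists j => //; rewrite -e subnK.
Qed.

(** * Complete trajectories, their limits, and attractors *)

(** A total way to turn nonnegative reals into times; its values elsewhere are
irrelevant. *)
Definition to_nng {R : realType} (t : R) : {nonneg R} := `|t|%:nng.

Lemma to_nngK {R : realType} (t : R) : 0 <= t -> (to_nng t)%:num = t.
Proof. exact: ger0_norm. Qed.

Section CompleteTrajectories.
Context {R : realType} {X : metricType R}.
Implicit Types (F : set (trajectory X)) (gamma : R -> X).

Lemma complete_shift F gamma c : complete_trajectory F gamma ->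
  complete_trajectory F (fun t => gamma (t + c)).
Proof.
move=> Fg h; have := Fg (h + c); congr F.
by apply/funext => t; rewrite addrA.
Qed.

(** Around [t], [gamma] is an element of [F] started at [t - 1], so that only
continuity at the interior time 1 of the half-line matters. *)
Lemma complete_continuous F gamma :
  (forall phi, F phi -> trajectory_continuous phi) ->
  complete_trajectory F gamma -> continuous gamma.
Proof.
move=> Fc Fg t W Wt; have /Fc /(_ 1%:nng) := Fg (t - 1).
move=> /(_ W) /=; rewrite subrKC => /(_ Wt) [_ [[C oC <-] /= C1 CW]].
have C1' : nbhs (1 : R) C by exact: open_nbhs_nbhs.
have /nbhs_ballP[d /= d0 dC] := C1'.
apply/nbhs_ballP; exists (Num.min d 1); first by rewrite /= lt_min d0 /=.
move=> u; rewrite /ball/= lt_min => /andP[tud tu1].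
have u0 : 0 <= u - (t - 1).
  by move: tu1; rewrite ltr_norml => /andP[_]; lra.
have := CW (NngNum u0); rewrite /= subrK; apply.
apply: dC; rewrite /ball/=.
by have -> : 1 - (u - (t - 1)) = t - u by lra.
Qed.

(** Complete trajectories that agree at time 0 can be spliced there by (K3).
Unlike (K3) itself, this form is symmetric under time reversal. *)
Definition splice (gamma1 gamma2 : R -> X) : R -> X :=
  fun t => if t < 0 then gamma1 t else gamma2 t.

Lemma complete_splice F gamma1 gamma2 : K3 F ->
  complete_trajectory F gamma1 -> complete_trajectory F gamma2 ->
  gamma1 0 = gamma2 0 -> complete_trajectory F (splice gamma1 gamma2).
Proof.
move=> k3 F1 F2 e12 h; have [h0|h0] := leP 0 h.
  have := F2 h; congr F; apply/funext => t; rewrite /splice ltNge.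
  by rewrite addr_ge0.
have h0' : 0 <= - h by lra.
apply: (k3 _ _ (NngNum h0') (F1 h) (F2 0)) => /= [||t th|t].
- by lra.
- by rewrite addr0 addNr e12.
- rewrite /splice; case: ltP => // th0.
  by have -> : t%:num + h = 0 by lra.
- by rewrite /splice addr0 addrAC addNr add0r ltNge ge0.
Qed.

Definition concat (u v : trajectory X) (s : R) : trajectory X :=
  fun t => if t%:num <= s then u t else v (to_nng (t%:num - s)).

Lemma concat_after (u v : trajectory X) (s t : {nonneg R}) : v 0%:nng = u s ->
  concat u v s%:num (s%:num + t%:num)%:nng = v t.
Proof.
move=> vu; rewrite /concat; case: leP => /= [st|st].
  have t0 : t = 0%:nng by apply: val_inj => /=; have : 0 <= t%:num by []; lra.
  by rewrite t0 vu; congr u; apply: val_inj; rewrite /= addr0.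
congr v; apply: val_inj.
by rewrite addrAC subrr add0r; exact: to_nngK.
Qed.

Lemma concat_mem F (u v : trajectory X) (s : {nonneg R}) : K3 F -> F u -> F v ->
  0 < s%:num -> v 0%:nng = u s -> F (concat u v s%:num).
Proof.
move=> k3 Fu Fv s0 vu; apply: (k3 _ _ _ Fu Fv s0 vu) => t.
  by rewrite /concat => ->.
exact: concat_after.
Qed.

End CompleteTrajectories.

Section Limits.
Context {R : realType} {X : metricType R}.
Implicit Types (F : set (trajectory X)) (gamma zeta : R -> X).

Definition unif_cv (S : set R) (u : nat -> R -> X) zeta := forall e, 0 < e ->
  exists N, forall k, (N <= k)%N -> forall t, S t -> mdist (u k t) (zeta t) < e.

Lemma unif_cv_pt (u : nat -> R -> X) zeta t :
  unif_cv [set t] u zeta -> seq_lim (u ^~ t) (zeta t).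
Proof. by move=> h e /h[N hN]; exists N => k /hN; apply. Qed.

(** Common form of the two compactness hypotheses: (K4) gives it with the
one-point windows, and uniform convergence on bounded intervals gives it with
the bounded windows.  The reindexing [r] is there because the property is
applied to sequences that have already been extracted. *)
Definition limits_along (W : set (set R)) (Fk : nat -> set (trajectory X)) F :=
  forall (r : nat -> nat) (phi : nat -> trajectory X) x0,
    (forall k, (k <= r k)%N) -> (forall k, Fk (r k) (phi k)) ->
    seq_lim (fun k => phi k 0%:nng) x0 ->
  exists (s : nat -> nat) (psi : trajectory X),
    [/\ forall k, (k <= s k)%N, F psi &
     forall S, W S -> forall e, 0 < e -> exists N, forall k, (N <= k)%N ->
      forall t : {nonneg R}, S t%:num -> mdist (phi (s k) t) (psi t) < e].

Definition point_windows : set (set R) := [set S | exists a, S = [set a]].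
Definition bounded_windows : set (set R) :=
  [set S | exists M, forall t, S t -> `|t| <= M].

Lemma nat_above (t : R) : exists N : nat, t <= N%:R.
Proof.
exists (Num.bound `|t|); apply: le_trans (ler_norm t) (ltW _).
exact: archi_boundP.
Qed.

(** For each [N], compactness of [K] makes the values at time [-N] converge
along a subsequence, and [limits_along] gives a limit on [[-N, +oo)]; a diagonal
subsequence works for all [N].  The limits on these half-lines agree by
uniqueness of pointwise limits, whence the assumption that all one-point sets
are windows. *)
Lemma limit_complete (W : set (set R)) (Fk : nat -> set (trajectory X)) F
    (K : set X) (gamma : nat -> R -> X) :
  (forall S c, W S -> W [set t | S (t + c)]) -> (forall a, W [set a]) ->
  K2 F -> limits_along W Fk F -> compact K ->
  (forall k, complete_trajectory (Fk k) (gamma k)) ->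
  (forall k t, K (gamma k t)) ->
  exists s zeta, [/\ forall k, (k <= s k)%N, complete_trajectory F zeta,
    forall t, K (zeta t) &
    forall S, W S -> has_lbound S -> unif_cv S (gamma \o s) zeta].
Proof.
move=> Wshift Wpt k2 lim cK Fg Kg.
pose P N r := exists2 psi, F psi & forall S, W S -> forall e, 0 < e ->
  exists M, forall k, (M <= k)%N -> forall t : {nonneg R}, S t%:num ->
  mdist (gamma (r k) (t%:num - N%:R)) (psi t) < e.
have [N r hr|N r r' [psi Fpsi hpsi] rr'|s hs Ps] := @diagonal_subsequence P.
- have [x [s [_ hs us]]] := compact_seq cK (fun k => Kg (r k) (- N%:R)).
  have hrs k : (k <= (r \o s) k)%N by exact: leq_trans (hr _).
  have [||s' [psi [hs' Fpsi cv]]] :=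
    lim (r \o s) (fun k t => gamma (r (s k)) (t%:num - N%:R)) x hrs.
  + by move=> k; exact: Fg.
  + by move=> e /us[M hM]; exists M => k /hM /=; rewrite add0r.
  exists (s \o s'); first by move=> k; exact: leq_trans (hs _).
  by exists psi.
- exists psi => // S WS e e0; have [M hM] := hpsi S WS e e0.
  exists (maxn N M) => k; rewrite geq_max => /andP[Nk Mk] t St.
  have [j kj ->] := rr' k Nk; apply: hM => //; exact: leq_trans kj.
have /choice[psi hpsi] : forall N, exists psi, F psi /\ forall S, W S ->
  forall e, 0 < e -> exists M, forall k, (M <= k)%N -> forall t : {nonneg R},
  S t%:num -> mdist (gamma (s k) (t%:num - N%:R)) (psi t) < e.
  by move=> N; have [psi] := Ps N; exists psi.
(* [psi N] is the limit on the half-line starting at [-N], with its origin moved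
   to 0. *)
have cvpt N (t : R) : 0 <= t + N%:R ->
    seq_lim (fun k => gamma (s k) t) (psi N (to_nng (t + N%:R))).
  move=> tN e e0; have [_ /(_ _ (Wpt (t + N%:R)) e e0)[M hM]] := hpsi N.
  exists M => k /hM /(_ (to_nng (t + N%:R))) /=.
  by rewrite ger0_norm // addrK; apply.
have large (t : R) : exists N : nat, 0 <= t + N%:R.
  by have [N hN] := nat_above (- t); exists N; rewrite addrC -lerBlDr sub0r.
have /choice[Nt hNt] := large.
pose zeta t := psi (Nt t) (to_nng (t + (Nt t)%:R)).
have zetaE N t : 0 <= t + N%:R -> zeta t = psi N (to_nng (t + N%:R)).
  by move=> tN; apply: seq_lim_unique (cvpt _ _ (hNt t)) (cvpt _ _ tN).
exists s, zeta; split=> // [h|t|S WS [b bS] e e0].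
- have [N hN] := large h; have [Fpsi _] := hpsi N.
  have := k2 (NngNum hN) _ Fpsi; congr F; apply/funext => t /=.
  rewrite (zetaE N); last by rewrite -addrA addr_ge0.
  by congr (psi N _); apply: val_inj; rewrite -addrA; apply/esym/to_nngK; rewrite addr_ge0.
- exact: compact_seq_lim cK (fun k => Kg (s k) t) (cvpt _ _ (hNt t)).
- have [N hN] := large b; have [_ cvN] := hpsi N.
  have [M hM] := cvN _ (Wshift _ (- N%:R) WS) e e0.
  exists M => k /hM{}hM t St.
  have tN : 0 <= t + N%:R by apply: le_trans hN _; rewrite lerD2r; exact: bS.
  rewrite (zetaE N)//; have := hM (to_nng (t + N%:R)).
  by rewrite /mkset to_nngK // addrK; apply.
Qed.

End Limits.

Section Attractors.
Context {R : realType} {X : metricType R}.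
Implicit Types (F : set (trajectory X)) (A B : set X) (gamma : R -> X).

Lemma nhd_all_seq A y : (forall e, 0 < e -> nhd e A y) ->
  exists2 u : nat -> X, (forall k, A (u k)) & seq_lim u y.
Proof.
move=> h; have /choice[u hu] : forall k : nat, exists x, A x /\ mdist y x < k.+1%:R^-1.
  by move=> k; have [|a Aa ya] := h k.+1%:R^-1; [rewrite invr_gt0|exists a].
exists u => [k|e e0]; first by case: (hu k).
have [N _ hN] := @near_infty_natSinv_lt R (PosNum e0).
exists N => k Nk; rewrite metric_sym; have [_ /lt_trans] := hu k; apply; exact: hN.
Qed.

Lemma compact_nhd_all A y : compact A -> (forall e, 0 < e -> nhd e A y) -> A y.
Proof. by move=> cA /nhd_all_seq[u Au uy]; exact: compact_seq_lim uy. Qed.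

Lemma compact_metric_bounded A : compact A -> metric_bounded A.
Proof.
move=> cA; have [->|/set0P[a Aa]] := eqVneq A set0; first by exists 0 => x y.
suff [M hM] : exists M, forall x, A x -> mdist x a <= M.
  exists (M + M) => x y Ax Ay; rewrite (le_trans (metric_triangle _ a _))//.
  by rewrite (metric_sym a) lerD// hM.
apply: contrapT => nM.
have /choice[u hu] : forall k : nat, exists x, A x /\ k%:R < mdist x a.
  move=> k; apply: contrapT => nx; apply: nM; exists k%:R => x Ax.
  by rewrite leNgt; apply/negP => xa; apply: nx; exists x.
have [x [s [Ax hs us]]] := compact_seq cA (fun k => (hu k).1).
have [N hN] := us 1 ltr01; have [N' hN'] := nat_above (1 + mdist x a).
pose k := maxn N N'; have /hN /= xk : (N <= k)%N by exact: leq_maxl.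
have N'k : N'%:R <= (s k)%:R :> R by rewrite ler_nat (leq_trans _ (hs k))// leq_maxr.
have [_ sk] := hu (s k).
by have := metric_triangle (u (s k)) x a; lra.
Qed.

Lemma nonneg_pinfty_filter : Filter (@nonneg_pinfty R).
Proof.
split=> [|P Q [M hM] [N hN]|P Q PQ [M hM]]; first by exists 0.
- exists (Num.max M N) => t; rewrite gt_max => /andP[Mt Nt].
  by split; [exact: hM|exact: hN].
- by exists M => t /hM /PQ.
Qed.

(** A closed set that attracts [B] contains each point that is reached from
[B] at arbitrarily large times. *)
Lemma attractor_absorbs F A B y : compact A -> global_attractor F A ->
  B !=set0 -> metric_bounded B ->
  (forall M, exists2 t : {nonneg R}, M < t%:num & Gset F t B y) -> A y.
Proof.
move=> cA [_ attr] B0 bB yB; apply: compact_nhd_all => // e e0.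
have [M hM] := cvge0_near_lt nonneg_pinfty_filter (attr B B0 bB) e0.
by have [t /hM /distX_lt tM /tM] := yB M.
Qed.

(** A point of [A] reached at time [s] from [A], followed up to [s + t], stays
within reach of [A] because of (K3); as [s] is arbitrary, the end point is
absorbed by [A]. *)
Lemma attractor_invariant F A (t : {nonneg R}) : K3 F -> compact A ->
  global_attractor F A -> Gset F t A `<=` A.
Proof.
move=> k3 cA attr y [x Ax [u [Fu ux] uy]].
have [t0|t0] := ltP 0 t%:num; last first.
  have e0t : t = 0%:nng by apply: val_inj; apply/eqP; rewrite /= eq_le t0 ge0.
  by rewrite -uy e0t ux.
apply: (attractor_absorbs cA attr (ex_intro _ x Ax) (compact_metric_bounded cA)).
move=> M; pose s : {nonneg R} := to_nng (`|M| + 1).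
have sE : s%:num = `|M| + 1 by apply: to_nngK; rewrite addr_ge0.
have s0 : 0 < s%:num by rewrite sE ltr_wpDl.
have [x' Ax' [v [Fv vx'] vx]] := attr.1 s x Ax.
exists (s%:num + t%:num)%:nng.
  by have := ler_norm M; rewrite /= sE; lra.
have uv : u 0%:nng = v s by rewrite ux vx.
exists x' => //; exists (concat v u s%:num); last by rewrite concat_after.
split; first exact: concat_mem.
by rewrite /concat /= ge0.
Qed.

(** The range of a complete trajectory is reached from itself at all times. *)
Lemma bounded_complete_in_attractor F A gamma : compact A ->
  global_attractor F A -> complete_trajectory F gamma ->
  metric_bounded (range gamma) -> forall t, A (gamma t).
Proof.
move=> cA attr Fg bg t; apply: (attractor_absorbs cA attr _ bg).
  by exists (gamma 0); exists 0.
move=> M; pose s : {nonneg R} := to_nng (`|M| + 1).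
have sE : s%:num = `|M| + 1 by apply: to_nngK; rewrite addr_ge0.
exists s; first by have := ler_norm M; rewrite sE; lra.
exists (gamma (t - s%:num)); first by exists (t - s%:num).
exists (fun r => gamma (r%:num + (t - s%:num))); last by rewrite subrKC.
by split; [exact: Fg|rewrite add0r].
Qed.

(** By [A `<=` Gset F 1 A], each point of [A] has a predecessor in [A] at time
1.  Prepending these predecessors one after the other, which (K3) allows, yields
trajectories [psi N] through the given point at time [N]; they extend each other
backwards and define the complete trajectory. *)
Lemma attractor_complete F A x : K1 F -> K2 F -> K3 F -> compact A ->
  global_attractor F A -> A x ->
  exists gamma, [/\ complete_trajectory F gamma, forall t, A (gamma t)
    & gamma 0 = x].
Proof.
move=> k1 k2 k3 cA attr Ax.
have [z zE] : exists z : {nonneg R}, z = 0%:nng by exists 0%:nng.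
have /choice[pre hpre] : forall y, exists u, A y ->
    [/\ F u, A (u z) & u 1%:nng = y].
  move=> y; have [Ay|nAy] := pselect (A y); last by have [u] := k1 x; exists u.
  by have [x' Ax' [u [Fu ux'] uy]] := attr.1 1%:nng y Ay; exists u; rewrite zE ux'.
have [phi Fphi phix] := k1 x.
pose back (v : trajectory X) := concat (pre (v z)) v 1.
pose psi N := iter N back phi.
have psi_spec N : F (psi N) /\ A (psi N z).
  elim: N => [|N [Fpsi Apsi]]; first by rewrite zE /= phix.
  rewrite /psi iterS -/(psi N).
  have [Fu Au u1] := hpre _ Apsi; split; last first.
    suff -> : back (psi N) z = pre (psi N z) z by [].
    by rewrite /back /concat ifT // zE.
  have e01 : 0 < (1%:nng : {nonneg R})%:num by [].
  by apply: (concat_mem k3 Fu Fpsi e01); rewrite u1 zE.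
have psiS N t : 0 <= t -> psi N.+1 (to_nng (t + 1)) = psi N (to_nng t).
  move=> t0; have [Fpsi Apsi] := psi_spec N; have [Fu Au u1] := hpre _ Apsi.
  have vu : psi N 0%:nng = pre (psi N z) 1%:nng by rewrite u1 zE.
  have := concat_after (to_nng t) vu; rewrite /= => <-.
  by congr (psi N.+1 _); apply: val_inj; rewrite /= to_nngK ?addr_ge0 //
    to_nngK // addrC.
have psiD m N t : 0 <= t -> psi (m + N)%N (to_nng (t + m%:R)) = psi N (to_nng t).
  move=> t0; elim: m => [|m IH]; first by rewrite addr0.
  by rewrite -natr1 addrA addSn psiS ?IH // addr_ge0.
have psiE M N (t : R) : 0 <= t + M%:R -> 0 <= t + N%:R ->
    psi M (to_nng (t + M%:R)) = psi N (to_nng (t + N%:R)).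
  wlog MN : M N / (M <= N)%N.
    by case/orP: (leq_total M N) => MN h t1 t2; [|apply/esym]; apply: h.
  move=> tM tN; rewrite -(psiD (N - M)%N M _ tM) subnK //; congr (psi N (to_nng _)).
  by rewrite -addrA -natrD subnKC.
have large (t : R) : exists N : nat, 0 <= t + N%:R.
  by have [N hN] := nat_above (- t); exists N; rewrite addrC -lerBlDr sub0r.
have /choice[Nt hNt] := large.
exists (fun t => psi (Nt t) (to_nng (t + (Nt t)%:R))); split.
- move=> h; have [N hN] := large h.
  have := k2 (NngNum hN) _ (psi_spec N).1; congr F; apply/funext => t /=.
  have tN : 0 <= t%:num + h + N%:R by rewrite -addrA addr_ge0.
  rewrite (psiE _ N) //; congr (psi N _); apply: val_inj => /=.
  by rewrite to_nngK // addrA.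
- move=> t; apply: (@attractor_invariant F A (to_nng (t + (Nt t)%:R))) => //.
  have [Fpsi Apsi] := psi_spec (Nt t).
  by exists (psi (Nt t) z) => //; exists (psi (Nt t)); rewrite ?zE.
- rewrite (psiE _ 0%N) ?addr0 //=; rewrite -phix; congr phi.
  by apply: val_inj; exact: to_nngK.
Qed.

End Attractors.

(** * Connections in the limit of a family of trajectories *)

Section Walks.
Context (n : nat) (e : 'I_n -> 'I_n -> Prop).

(** Pigeonhole: an endless walk on a finite set closes up. *)
Lemma walk_cycle (f : nat -> 'I_n) : (forall k, e (f k) (f k.+1)) ->
  exists k (p : 'I_k.+1 -> 'I_n), forall i, e (p i) (p (ordS i)).
Proof.
move=> ef; have [a [b [ab fab]]] : exists a b, (a < b)%N /\ f a = f b.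
  have /injectivePn[x [y xy fxy]] : ~~ injectiveb (fun i : 'I_n.+1 => f i).
    by apply/negP => /injectiveP/leq_card; rewrite !card_ord ltnn.
  case/orP: (leq_total x y) => lexy; last rewrite eq_sym in xy.
    by exists x, y; split=> //; rewrite ltn_neqAle lexy andbT.
  by exists y, x; split=> //; rewrite ltn_neqAle lexy andbT.
have bE : (a + (b - a).-1.+1 = b)%N by rewrite prednK ?subn_gt0 // subnKC // ltnW.
exists (b - a).-1, (fun i => f (a + i)%N) => i /=.
have := ltn_ord i; rewrite ltnS leq_eqVlt => /orP[/eqP ik|ik].
  have -> : (i.+1 %% (b - a).-1.+1 = 0)%N by rewrite ik modnn.
  have -> : f (a + 0)%N = f (a + i).+1 by rewrite addn0 fab ik -addnS bE.
  exact: ef.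
by rewrite modn_small ?ltnS // addnS; exact: ef.
Qed.

End Walks.

Lemma backward_walk_cycle n (e : 'I_n -> 'I_n -> Prop) (f : nat -> 'I_n) :
  (forall k, e (f k.+1) (f k)) ->
  exists k (p : 'I_k.+1 -> 'I_n), forall i, e (p i) (p (ordS i)).
Proof.
move=> ef; have [k [p hp]] := @walk_cycle n (fun i j => e j i) f ef.
exists k, (p \o @rev_ord _) => i /=.
suff {1}-> : rev_ord i = ordS (rev_ord (ordS i)) by [].
apply: val_inj => /=; have := ltn_ord i.
rewrite ltnS leq_eqVlt => /orP[/eqP ->|ik]; first by rewrite modnn subn1 /= modnn subnn.
by rewrite (@modn_small i.+1) ?ltnS // !subSS subnSK // modn_small // ltnS leq_subr.
Qed.

Lemma real_subsequence {R : realType} (B : R) (b : nat -> R) :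
  (forall k, 0 <= b k <= B) ->
  exists l s, [/\ 0 <= l <= B, forall k, (k <= s k)%N & forall e, 0 < e ->
    exists N, forall k, (N <= k)%N -> `|l - b (s k)| < e].
Proof.
move=> hb; have bB k : [set` `[0, B]] (b k) by rewrite /= in_itv; exact: hb.
have [l [s [lB hs ls]]] := @compact_seq _ R^o _ _ (@segment_compact R 0 B) bB.
by exists l, s; split=> //; move: lB; rewrite /= in_itv.
Qed.

Section LimitSystem.
Context {R : realType} {X : metricType R} {n : nat}.
Implicit Types (L : set (R -> X)) (T : R -> set (R -> X)) (Xi : 'I_n -> set X).

(** What the argument needs of a family [T eta] of complete trajectories, of
the set [L] of its limits as [eta -> 0], and of the sets [Xi i].  The axioms are
chosen to be invariant under time reversal: [L] and [T] are sets of two-sided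
trajectories, and (K3) enters only through [ls_splice].  The bound in
[ls_limit] is a convenient way to say that [eta k] tends to 0.  The factor 2 in
[ls_disjoint] leaves room for limits of points of the [r]-neighbourhoods. *)
Record limit_system L T Xi (r : R) : Prop := LimitSystem {
  ls_gt0 : 0 < r;
  ls_continuous0 : forall gamma, L gamma -> continuous gamma;
  ls_continuous : forall eta gamma, T eta gamma -> continuous gamma;
  ls_shift0 : forall gamma c, L gamma -> L (fun t => gamma (t + c));
  ls_shift : forall eta gamma c, T eta gamma -> T eta (fun t => gamma (t + c));
  ls_splice : forall gamma1 gamma2, L gamma1 -> L gamma2 ->
    gamma1 0 = gamma2 0 -> L (splice gamma1 gamma2);
  ls_limit : forall (eta : nat -> R) (gamma : nat -> R -> X),
    (forall k, 0 < eta k <= k.+1%:R^-1) -> (forall k, T (eta k) (gamma k)) ->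
    exists s zeta, [/\ forall k, (k <= s k)%N, L zeta
      & forall M, unif_cv [set t | `|t| <= M] (gamma \o s) zeta];
  ls_forward : forall gamma, L gamma -> exists j, approaches gamma (Xi j);
  ls_backward : forall gamma, L gamma ->
    exists i, approaches (fun t => gamma (- t)) (Xi i);
  ls_disjoint : forall i j x, nhd (2 * r) (Xi i) x -> nhd (2 * r) (Xi j) x -> i = j;
  ls_closed : forall i x, (forall e, 0 < e -> nhd e (Xi i) x) -> Xi i x;
  ls_invariant : forall i x, Xi i x ->
    exists gamma, [/\ L gamma, forall t, Xi i (gamma t) & gamma 0 = x]
}.

Definition time_reversal (L : set (R -> X)) : set (R -> X) :=
  [set gamma | L (fun t => gamma (- t))].

Lemma limit_system_reversal L T Xi r : limit_system L T Xi r ->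
  limit_system (time_reversal L) (fun eta => time_reversal (T eta)) Xi r.
Proof.
have oppK (gamma : R -> X) : (fun t => gamma (- - t)) = gamma.
  by apply/funext => t; rewrite opprK.
have cont (gamma : R -> X) : continuous (fun t => gamma (- t)) -> continuous gamma.
  move=> cg t; have : {for t, continuous ((fun u => gamma (- u)) \o (@GRing.opp R))}.
    by apply: continuous_comp; [exact: oppr_continuous|exact: cg].
  by rewrite (_ : _ \o _ = gamma) //; exact: oppK.
have shift (S : set (R -> X)) gamma c :
    (forall gamma c, S gamma -> S (fun t => gamma (t + c))) ->
    time_reversal S gamma -> time_reversal S (fun t => gamma (t + c)).
  move=> hS Sg; have := hS _ (- c) Sg; congr S; apply/funext => t.
  by rewrite opprD opprK.
case=> r0 c0 c s0 s g l fw bw dj cl iv; split=> //.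
- by move=> gamma /c0 /cont.
- by move=> eta gamma /c /cont.
- by move=> gamma d; apply: shift.
- by move=> eta gamma d; apply: shift => // *; exact: s.
- move=> gamma1 gamma2 h1 h2 e; have := g _ _ h2 h1.
  rewrite oppr0 e => /(_ erefl); congr L; apply/funext => t; rewrite /splice oppr_lt0.
  by case: ltgtP => // ->; rewrite oppr0.
- move=> eta gamma heta hgamma; have [sg [zeta [hs T0z cv]]] := l eta _ heta hgamma.
  exists sg, (fun t => zeta (- t)); split=> //; first by rewrite /time_reversal /= oppK.
  move=> M e e0; have [N hN] := cv M e e0; exists N => k /hN{}hN t /= tM.
  by have := hN (- t); rewrite /= normrN opprK; apply.
- by move=> gamma /bw; rewrite oppK.
- by move=> gamma /fw.
- move=> i x /iv[gamma [T0g gXi g0]]; exists (fun t => gamma (- t)).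
  by split=> //; [rewrite /time_reversal /= oppK|rewrite oppr0].
Qed.

(** The last condition makes a connection from [Xi i] to itself a homoclinic
orbit with one trajectory, so that cycles of connections are exactly homoclinic
orbits. *)
Definition connection L Xi i j := exists zeta, [/\ L zeta,
  approaches (fun t => zeta (- t)) (Xi i), approaches zeta (Xi j)
  & exists t, ~ (Xi i `|` Xi j) (zeta t)].

Lemma connection_reversal L Xi i j :
  connection (time_reversal L) Xi i j -> connection L Xi j i.
Proof.
case=> zeta [T0z zi zj [t zt]]; exists (fun t => zeta (- t)); split=> //.
  by have -> : (fun t => zeta (- - t)) = zeta by apply/funext => u; rewrite opprK.
by exists (- t); rewrite opprK setUC.
Qed.

Lemma limit_visits (u : nat -> R -> X) (s : nat -> nat) zeta A :
  (forall k, (k <= s k)%N) ->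
  (forall M, unif_cv [set t | `|t| <= M] (u \o s) zeta) -> approaches zeta A ->
  forall e N, 0 < e -> exists k t, (N <= k)%N /\ nhd e A (u k t).
Proof.
move=> hs cv zA e N e0; have e20 : 0 < e / 2 by lra.
have [M hM] := zA _ e20; have [N' hN'] := cv `|M + 1| _ e20.
pose k := maxn N N'; exists (s k), (M + 1); split.
  by apply: leq_trans (hs k); exact: leq_maxl.
rewrite (splitr e); apply: nhd_near (hM (M + 1) _) _; first by lra.
by rewrite metric_sym; apply: hN' => //=; exact: leq_maxr.
Qed.

(** When [zeta] meets [Xi i] at the time [- b], its past before [- b] can be
traded for a trajectory inside [Xi i].  Such a replacement is needed because a
trajectory starting in [Xi i] may leave it: solutions are not unique. *)
Lemma gluing_at_departure L T Xi r i zeta b : limit_system L T Xi r ->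
  L zeta -> 0 <= b -> Xi i (zeta (- b)) ->
  (forall t, - b < t -> t < 0 -> nhd (2 * r) (Xi i) (zeta t)) ->
  exists zeta', [/\ L zeta', forall t, 0 <= t -> zeta' t = zeta t
    & forall t, t < 0 -> nhd (2 * r) (Xi i) (zeta' t)].
Proof.
move=> ls T0z b0 zb zt; have [psi [T0psi psiXi psi0]] := ls_invariant ls zb.
have r20 : 0 < 2 * r by have := ls_gt0 ls; lra.
exists (fun t => splice psi (fun t => zeta (t - b)) (t + b)); split.
- apply: (ls_shift0 ls); apply: (ls_splice ls) => //; first exact: (ls_shift0 ls).
  by rewrite psi0 add0r.
- by move=> t t0; rewrite /splice addrK ltNge addr_ge0.
- move=> t t0; rewrite /splice; case: ltP => tb; first exact: nhd_self.
  rewrite addrK; move: tb; rewrite le_eqVlt => /orP[/eqP tb|tb].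
    by have -> : t = - b; [lra|exact: nhd_self].
  by apply: zt => //; lra.
Qed.

(** Recentring [gamma k] at the first time it leaves the [r]-neighbourhood of
[Xi i] gives a limit [zeta] with [zeta 0] outside [Xi i].  It is near [Xi i] at
all negative times, possibly after a change of its past, and hence comes from
[Xi i]; the set [Xi j] it goes to is approached by the [gamma k] as well. *)
Lemma connection_step L T Xi r i (eta s : nat -> R) (gamma : nat -> R -> X) :
  limit_system L T Xi r ->
  (forall k, 0 < eta k <= k.+1%:R^-1) -> (forall k, T (eta k) (gamma k)) ->
  (forall k, nhd k.+1%:R^-1 (Xi i) (gamma k (s k))) ->
  (forall k, exists t, s k <= t /\ ~ nhd r (Xi i) (gamma k t)) ->
  exists2 j, connection L Xi i j &
    forall e N, 0 < e -> exists k t, (N <= k)%N /\ nhd e (Xi j) (gamma k t).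
Proof.
move=> ls etas Tg near exits; have r0 := ls_gt0 ls.
have /choice[tau htau] : forall k, exists tau, [/\ s k <= tau,
    ~ nhd r (Xi i) (gamma k tau)
    & forall t, s k <= t < tau -> nhd r (Xi i) (gamma k t)].
  move=> k; have [t [st nt]] := exits k.
  have [tau [/andP[stau _] ntau h]] :=
    first_exit (ls_continuous ls (Tg k)) (open_nhd (X := X) r (Xi i)) st nt.
  by exists tau.
pose u k t := gamma k (t + tau k).
have [sg [zeta [hsg Lz cv]]] := ls_limit ls etas (fun k => ls_shift ls (tau k) (Tg k)).
rewrite -/u in cv.
have upt t : seq_lim (fun k => u (sg k) t) (zeta t).
  move=> e e0; have [N hN] := cv `|t| e e0.
  by exists N => k /hN; apply => /=.
have nz : ~ Xi i (zeta 0).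
  move=> zXi; have [N hN] := upt 0 r r0.
  have [_ ntau _] := htau (sg N); apply: ntau.
  by exists (zeta 0) => //; have := hN N (leqnn N); rewrite /u add0r.
have [zeta' [Lz' zeta'E zeta'N]] : exists zeta', [/\ L zeta',
    forall t, 0 <= t -> zeta' t = zeta t
    & forall t, t < 0 -> nhd (2 * r) (Xi i) (zeta' t)].
  (* Infinitely many of the recentred trajectories are, at time [t], between
     the approach to [Xi i] and the exit. *)
  have late t : t < 0 ->
      (forall N, exists2 k, (N <= k)%N & s (sg k) <= t + tau (sg k)) ->
      nhd (2 * r) (Xi i) (zeta t).
    move=> t0 freq; apply: (@nhd_seq_lim _ _ r) (upt t); first by lra.
    move=> N; have [k Nk sk] := freq N; exists k => //.
    have [_ _] := htau (sg k); apply; rewrite sk /=; lra.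
  have [far|/existsNP[B /existsNP[N near_exit]]] := pselect (forall B N, exists2 k,
      (N <= k)%N & B <= tau (sg k) - s (sg k)).
    exists zeta; split=> // t t0; apply: late => // N.
    by have [k Nk Bk] := far (- t) N; exists k => //; lra.
  pose m k := sg (k + N)%N.
  have bB k : 0 <= tau (m k) - s (m k) <= B.
    have [stau _ _] := htau (m k); rewrite subr_ge0 stau /=.
    rewrite leNgt; apply/negP => Bt; apply: near_exit.
    by exists (k + N)%N; [exact: leq_addl|exact: ltW].
  (* The time from approach to exit stays bounded: along a subsequence it
     tends to [b], and [zeta (- b)] is in [Xi i]. *)
  have [b [sb [/andP[b0 _] hsb bcv]]] := real_subsequence bB.
  have cz : continuous zeta := ls_continuous0 ls Lz.
  apply: (gluing_at_departure ls Lz b0).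
    apply: (ls_closed ls) => e e0; have e30 : 0 < e / 3 by lra.
    have [d /= d0 hd] : exists2 d, 0 < d & forall t, `|- b - t| < d ->
        mdist (zeta (- b)) (zeta t) < e / 3.
      have := cz (- b) _ (nbhsx_ballx _ _ e30).
      by move=> /nbhs_ballP[d d0 hd]; exists d => // t /hd /=; rewrite ballEmdist.
    have [N1 hN1] := bcv d d0; have [N2 hN2] := cv B _ e30.
    have [N3 _ hN3] := @near_infty_natSinv_lt R (PosNum e30).
    pose k := maxn N1 (maxn N2 N3); pose q := (sb k + N)%N.
    have kq : (k <= q)%N by apply: leq_trans (hsb k) (leq_addr _ _).
    have /hN1 bk : (N1 <= k)%N by exact: leq_maxl.
    have /hN2 cvq : (N2 <= q)%N by rewrite (leq_trans _ kq)// leq_max leq_maxl orbT.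
    have /hN3 /= invq : (N3 <= sg q)%N.
      by rewrite (leq_trans _ (hsg q))// (leq_trans _ kq)// leq_max leq_maxr !orbT.
    pose c := tau (m (sb k)) - s (m (sb k)).
    have /andP[c0 cB] : 0 <= c <= B by exact: bB.
    have zc : mdist (zeta (- b)) (zeta (- c)) < e / 3.
      by apply: hd; rewrite opprK addrC -distrC; exact: bk.
    have uc : mdist (u (sg q) (- c)) (zeta (- c)) < e / 3.
      by apply: cvq; rewrite /= normrN ger0_norm.
    have := near (sg q); have -> : s (sg q) = - c + tau (sg q).
      by rewrite /c /m -/q opprB subrK.
    rewrite -/(u _ _) => /(nhd_le (ltW invq)) h.
    rewrite metric_sym in zc; apply: nhd_le (nhd_near (nhd_near h uc) zc).
    by lra.
  move=> t bt t0; apply: late => // M.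
  have bt0 : 0 < t + b by lra.
  have [N1 hN1] := bcv _ bt0; pose k := maxn N1 M.
  exists (sb k + N)%N.
    rewrite (leq_trans _ (leq_addr _ _))// (leq_trans _ (hsb k))//; exact: leq_maxr.
  have /hN1 : (N1 <= k)%N by exact: leq_maxl.
  by rewrite ltr_norml => /andP[]; rewrite /m; lra.
have [i' zi'] := ls_backward ls Lz'; have [j zj] := ls_forward ls Lz'.
have r20 : 0 < 2 * r by lra.
have ii' : i' = i.
  have [M hM] := zi' _ r20; pose t := `|M| + 1.
  apply: (ls_disjoint ls (hM t _) (zeta'N (- t) _)); rewrite /t.
    by have := ler_norm M; lra.
  by have := normr_ge0 M; lra.
subst i'; exists j.
  exists zeta'; split=> //; exists 0; rewrite zeta'E // => -[//|zXj].
  (* If [zeta' 0] were in [Xi j], [zeta'] would be close to [Xi j] shortly before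
     time 0, while it is close to [Xi i] then. *)
  suff ij : i = j by apply: nz; rewrite ij.
  have cz : continuous zeta' := ls_continuous0 ls Lz'.
  have /(cz 0) : nbhs (zeta' 0) (nhd (2 * r) (Xi j)).
    apply: open_nbhs_nbhs; split; first exact: open_nhd.
    by rewrite zeta'E //; exact: nhd_self.
  move=> /nbhs_ballP[d /= d0 hd]; have d20 : - (d / 2) < 0 by lra.
  apply: (ls_disjoint ls (zeta'N _ d20)); apply: hd.
  by rewrite /ball /= sub0r opprK ger0_norm; lra.
have zjz : approaches zeta (Xi j).
  move=> e /zj[M hM]; exists (Num.max M 0) => t; rewrite gt_max => /andP[Mt t0].
  by rewrite -zeta'E ?ltW //; exact: hM.
move=> e N e0; have [k [t [Nk ukt]]] := limit_visits hsg cv zjz N e0.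
by exists k, (t + tau k).
Qed.

(** If [E eta] were nonempty for arbitrarily small [eta], its members would come
arbitrarily close to some [Xi j], by a limit of such members.  The property
[Near j] of being visited like this is inherited along some connection starting
at [j]: the last hypothesis turns visits into visits followed by exits, to which
[connection_step] applies.  So there would be an endless walk of connections. *)
Lemma no_bad_trajectory L T Xi r (E : R -> (R -> X) -> Prop) :
  limit_system L T Xi r ->
  ~ (exists f : nat -> 'I_n, forall k, connection L Xi (f k) (f k.+1)) ->
  (forall eta gamma, E eta gamma -> T eta gamma) ->
  (forall e, 0 < e -> exists2 h, 0 < h & forall eta gamma j s, 0 < eta <= h ->
    E eta gamma -> nhd e (Xi j) (gamma s) ->
    exists gamma' s', [/\ E eta gamma', nhd e (Xi j) (gamma' s')
      & exists t, s' <= t /\ ~ nhd r (Xi j) (gamma' t)]) ->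
  exists2 eta0, 0 < eta0 & forall eta gamma, 0 < eta <= eta0 -> ~ E eta gamma.
Proof.
move=> ls nowalk ET hE; apply: contrapT => noeta0.
pose Near j := forall e, 0 < e -> exists eta gamma s,
  [/\ 0 < eta <= e, E eta gamma & nhd e (Xi j) (gamma s)].
have inv0 k : 0 < k.+1%:R^-1 :> R by rewrite invr_gt0.
have invlt e : 0 < e -> exists N, forall k, (N <= k)%N -> k.+1%:R^-1 < e :> R.
  by move=> e0; have [N _ hN] := @near_infty_natSinv_lt R (PosNum e0); exists N.
have [j0 Nj0] : exists j, Near j.
  have /choice[eg heg] : forall k : nat, exists eg : R * (R -> X),
      0 < eg.1 <= k.+1%:R^-1 /\ E eg.1 eg.2.
    move=> k; apply: contrapT => neg; apply: noeta0; exists k.+1%:R^-1 => //.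
    by move=> eta gamma heta Eg; apply: neg; exists (eta, gamma).
  have [sg [zeta [hsg Lz cv]]] := ls_limit ls (fun k => (heg k).1)
    (fun k => ET _ _ (heg k).2).
  have [j zj] := ls_forward ls Lz; exists j => e e0.
  have [N hN] := invlt e e0.
  have [k [t [Nk ukt]]] := limit_visits hsg cv zj N e0.
  exists (eg k).1, (eg k).2, t; have [/andP[eg0 egk] Ek] := heg k; split=> //.
  by rewrite eg0 (le_trans egk)// ltW// hN.
have step j : Near j -> exists j', connection L Xi j j' /\ Near j'.
  move=> Nj.
  have /choice[eg heg] : forall k : nat, exists eg : R * (R -> X) * R,
      [/\ 0 < eg.1.1 <= k.+1%:R^-1, E eg.1.1 eg.1.2,
        nhd k.+1%:R^-1 (Xi j) (eg.1.2 eg.2)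
        & exists t, eg.2 <= t /\ ~ nhd r (Xi j) (eg.1.2 t)].
    move=> k; have [h h0 hh] := hE _ (inv0 k).
    have [|eta [gamma [s [/andP[eta0 etak] Eg gs]]]] := Nj (Num.min h k.+1%:R^-1).
      by rewrite lt_min h0 inv0.
    move: etak; rewrite le_min => /andP[etah etak].
    have [||gamma' [s' [Eg' gs' ex]]] := hh eta gamma j s _ Eg.
    - by rewrite eta0.
    - by apply: nhd_le gs; rewrite ge_min lexx orbT.
    by exists (eta, gamma', s'); split=> //=; rewrite eta0.
  have [k|k|k|k|j' cjj' visits] := @connection_step L T Xi r j
    (fun k => (eg k).1.1) (fun k => (eg k).2) (fun k => (eg k).1.2) ls.
  - by have [] := heg k.
  - by have [_ /ET] := heg k.
  - by have [] := heg k.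
  - by have [] := heg k.
  exists j'; split=> // e e0; have [N hN] := invlt e e0.
  have [k [t [Nk ukt]]] := visits e N e0.
  exists (eg k).1.1, (eg k).1.2, t; have [/andP[eg0 egk] Ek _ _] := heg k.
  by split=> //; rewrite eg0 (le_trans egk)// ltW// hN.
have /choice[g hg] : forall j, exists j', Near j -> connection L Xi j j' /\ Near j'.
  move=> j; have [/step[j' hj']|nj] := pselect (Near j); first by exists j'.
  by exists j.
have Nf k : Near (iter k g j0) by elim: k => //= k /hg[].
by apply: nowalk; exists (fun k => iter k g j0) => k; have [] := hg _ (Nf k).
Qed.

(** A trajectory that leaves each neighbourhood again and again turns every
visit into a visit followed by an exit by itself. *)
Lemma eventually_near L T Xi r : limit_system L T Xi r ->
  ~ (exists f : nat -> 'I_n, forall k, connection L Xi (f k) (f k.+1)) ->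
  exists2 eta0, 0 < eta0 & forall eta gamma, 0 < eta <= eta0 -> T eta gamma ->
    exists i s, forall t, s <= t -> nhd r (Xi i) (gamma t).
Proof.
move=> ls nowalk; pose restless eta gamma := T eta gamma /\
  forall i s, exists t, s <= t /\ ~ nhd r (Xi i) (gamma t).
have [|e e0|h h0 hh] := @no_bad_trajectory L T Xi r restless ls nowalk.
- by move=> eta gamma [].
- exists 1 => // eta gamma j s _ [Tg leaves] near_j.
  by exists gamma, s; split.
exists h => // eta gamma etah Tg; apply: contrapT => ns; apply: (hh eta gamma etah).
split=> // i s; apply: contrapT => nt; apply: ns; exists i, s => t st.
by apply: contrapT => nr; apply: nt; exists t.
Qed.

End LimitSystem.

(** * Maximal invariant sets as limits *)

Lemma increasing_seq_ge (s : nat -> nat) k : increasing_seq s -> (k <= s k)%N.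
Proof.
move=> /increasing_seqP hs; elim: k => // k IH.
by have := hs k; rewrite ltEnat; exact: leq_ltn_trans.
Qed.

Lemma uniform_radius {R : realType} n (P : 'I_n -> R -> Prop) :
  (forall i r r', r' <= r -> P i r -> P i r') ->
  (forall i, exists2 r, 0 < r & P i r) -> exists2 r, 0 < r & forall i, P i r.
Proof.
move=> mono hP; have /choice[r hr] : forall i, exists r, 0 < r /\ P i r.
  by move=> i; have [r] := hP i; exists r.
exists (\big[Num.min/1]_(i < n) r i).
  by apply: lt_bigmin => // i _; have [] := hr i.
by move=> i; apply: mono (hr i).2; exact: bigmin_le.
Qed.

Section Invariance.
Context {R : realType} {X : metricType R}.
Implicit Types (F : set (trajectory X)) (A Z : set X) (gamma : R -> X).

Lemma K4_limits F : K4 F -> limits_along point_windows (fun _ => F) F.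
Proof.
move=> k4 rho phi x0 _ Fphi /seq_limP phi0.
have [s [psi [s_incr Fpsi cv]]] := k4 phi x0 Fphi phi0.
exists s, psi; split=> // [k|S [a ->] e e0]; first exact: increasing_seq_ge.
have /seq_limP/(_ e e0)[N hN] := cv (to_nng a).
exists N => k Nk t /= ta; suff -> : t = to_nng a by exact: hN.
by apply: val_inj; apply: (etrans ta); apply/esym/to_nngK; rewrite -ta.
Qed.

Lemma K4_limit_complete F (K : set X) (gamma : nat -> R -> X) :
  K2 F -> K4 F -> compact K -> (forall k, complete_trajectory F (gamma k)) ->
  (forall k t, K (gamma k t)) ->
  exists s zeta, [/\ forall k, (k <= s k)%N, complete_trajectory F zeta,
    forall t, K (zeta t) & forall t, seq_lim (fun k => gamma (s k) t) (zeta t)].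
Proof.
move=> k2 k4 cK Fg Kg.
have [||s [zeta [hs Fz Kz cv]]] := limit_complete _ _ k2 (K4_limits k4) cK Fg Kg.
- move=> S c [a ->]; exists (a - c); apply/seteqP; split=> t /=.
    by move=> <-; rewrite addrK.
  by move=> ->; rewrite subrK.
- by move=> a; exists a.
exists s, zeta; split=> // t; apply: (@unif_cv_pt _ _ (gamma \o s)); apply: cv; first by exists t.
by exists t => u /= ->.
Qed.

Lemma range_weakly_invariant F gamma :
  complete_trajectory F gamma -> weakly_invariant F (range gamma).
Proof.
move=> Fg _ [s _ <-]; exists (fun t => gamma (t + s)).
split; [exact: complete_shift|by move=> t; exists (t + s)|by rewrite add0r].
Qed.

(** The closure of [Z] is weakly invariant, as a limit of trajectories in [Z],
and is contained in the neighbourhood in which [Z] is maximal. *)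
Lemma isolated_invariant_closed F A Z delta x : K2 F -> K4 F -> compact A ->
  Z `<=` A -> 0 < delta -> maximal_weakly_invariant F (thickening delta Z) Z ->
  (forall e, 0 < e -> nhd e Z x) -> Z x.
Proof.
move=> k2 k4 cA ZA d0 [Zinv _ Zmax]; move: x.
apply: (Zmax [set x | forall e, 0 < e -> nhd e Z x]); last first.
  by move=> x; rewrite thickeningE; apply.
move=> x /= /nhd_all_seq[u Zu ux].
have /choice[gamma hgamma] := fun k => Zinv _ (Zu k).
have [||s [zeta [hs Fz _ cv]]] := @K4_limit_complete F A gamma k2 k4 cA.
- by move=> k; have [] := hgamma k.
- by move=> k t; apply: ZA; have [] := hgamma k.
exists zeta; split=> // [t e e0|].
  apply: (@nhd_seq_lim _ _ (e / 2)) (cv t); first by lra.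
  move=> N; exists N => //; apply: nhd_self; first by lra.
  by have [] := hgamma (s N).
apply: seq_lim_unique (cv 0) _ => e /ux[N hN]; exists N => k Nk.
have [_ _ ->] := hgamma (s k); exact: hN (leq_trans Nk (hs k)).
Qed.

Lemma nhd_in_open A Z V : compact A -> Z `<=` A ->
  (forall x, (forall e, 0 < e -> nhd e Z x) -> Z x) -> Z `<=` interior V ->
  exists2 r, 0 < r & nhd r Z `<=` V.
Proof.
move=> cA ZA clZ ZV; apply: contrapT => nr.
have /choice[xa hxa] : forall k : nat, exists xa : X * X,
    [/\ Z xa.2, mdist xa.1 xa.2 < k.+1%:R^-1 & ~ V xa.1].
  move=> k; apply: contrapT => nx; apply: nr; exists k.+1%:R^-1.
    by rewrite invr_gt0.
  move=> x [a Za xa]; apply: contrapT => nVx; apply: nx; by exists (x, a).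
have [|a [s [_ hs sa]]] := @compact_seq _ _ A (fun k => (xa k).2) cA.
  by move=> k; apply: ZA; have [] := hxa k.
have Za : Z a.
  apply: clZ => e e0; apply: (@nhd_seq_lim _ _ (e / 2)) sa; first by lra.
  by move=> N; exists N => //=; apply: nhd_self; [lra|have [] := hxa (s N)].
have := ZV _ Za; rewrite /interior -metricType_numDomainType.filter_from_mdist_nbhs => -[d /= d0 dV].
have d20 : 0 < d / 2 by lra.
have [N hN] := sa _ d20; have [M _ hM] := @near_infty_natSinv_lt R (PosNum d20).
pose k := s (maxn N M); have [_ xak nVx] := hxa k; apply: nVx; apply: dV => /=.
have ak : mdist (xa k).2 a < d / 2 by apply: hN; exact: leq_maxl.
have kd : k.+1%:R^-1 < d / 2.
  by apply: hM; rewrite /=; apply: leq_trans (hs _); exact: leq_maxr.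
rewrite metric_sym; have := metric_triangle (xa k).1 (xa k).2 a.
have := lt_trans xak kd; lra.
Qed.

(** The limit of the [gamma k] is a complete trajectory that stays in the
closed [r]-neighbourhood of [Z], hence in [V]; its range is weakly invariant and
so contained in the maximal set [Xi]. *)
Lemma limits_in_invariant F A Z Xi V r (gamma : nat -> R -> X) :
  K2 F -> K4 F -> compact A -> 0 < r ->
  maximal_weakly_invariant F V Xi -> nhd (2 * r) Z `<=` V ->
  (forall k, complete_trajectory F (gamma k)) -> (forall k t, A (gamma k t)) ->
  (forall t, exists N, forall k, (N <= k)%N -> nhd r Z (gamma k t)) ->
  forall e, 0 < e -> exists k, nhd e Xi (gamma k 0).
Proof.
move=> k2 k4 cA r0 [_ _ Ximax] ZV Fg Ag Zg e e0.
have [s [zeta [hs Fz _ cv]]] := K4_limit_complete k2 k4 cA Fg Ag.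
have Xiz : Xi (zeta 0).
  apply: (Ximax (range zeta)) (range_weakly_invariant Fz) _ _ _; last by exists 0.
  move=> _ [t _ <-]; apply: ZV; apply: (@nhd_seq_lim _ _ r) (cv t); first by lra.
  move=> N; have [M hM] := Zg t; exists (maxn N M); first exact: leq_maxl.
  by apply: hM; apply: leq_trans (hs _); exact: leq_maxr.
have [N hN] := cv 0 _ e0; exists (s N); exists (zeta 0) => //; exact: hN.
Qed.

(** The sign [sgn] selects the direction of time: the forward and the backward
limits of [gamma] are both limits of translates of [gamma]. *)
Lemma eventually_near_approaches F A Z Xi V r gamma (sgn : bool) :
  K2 F -> K4 F -> compact A -> 0 < r ->
  maximal_weakly_invariant F V Xi -> nhd (2 * r) Z `<=` V ->
  complete_trajectory F gamma -> (forall t, A (gamma t)) ->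
  (exists s, forall t, s <= t -> nhd r Z (gamma ((-1) ^+ sgn * t))) ->
  approaches (fun t => gamma ((-1) ^+ sgn * t)) Xi.
Proof.
move=> k2 k4 cA r0 Ximax ZV Fg Ag [s hs] e e0; apply: contrapT => nM.
have /choice[t ht] : forall k : nat, exists t, k%:R < t /\ ~ nhd e Xi (gamma ((-1) ^+ sgn * t)).
  move=> k; apply: contrapT => nt; apply: nM; exists k%:R => t kt.
  by apply: contrapT => nXi; apply: nt; exists t.
have [||u|k] := @limits_in_invariant F A Z Xi V r
  (fun k u => gamma (u + (-1) ^+ sgn * t k)) k2 k4 cA r0 Ximax ZV _ _ _ e e0.
- by move=> k; exact: complete_shift.
- by [].
- have [N hN] := nat_above (s + `|u|); exists N => k Nk.
  have -> : u + (-1) ^+ sgn * t k = (-1) ^+ sgn * ((-1) ^+ sgn * u + t k).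
    by rewrite mulrDr mulrA -expr2 sqrr_sign mul1r.
  apply: hs; have [kt _] := ht k; have : N%:R <= k%:R :> R by rewrite ler_nat.
  have := ler_norm (- ((-1) ^+ sgn * u)); rewrite normrN normrM normr_sign mul1r.
  by lra.
- by rewrite add0r; have [] := ht k.
Qed.

End Invariance.

(** * Stability of the gradient structure *)

Section AttractorTrajectories.
Context {R : realType} {X : metricType R}.
Implicit Types (F : set (trajectory X)) (A : set X) (gamma : R -> X).

Definition trajectories_in F A : set (R -> X) :=
  [set gamma | complete_trajectory F gamma /\ forall t, A (gamma t)].

Lemma bounded_complete_trajectoriesE F A : compact A -> global_attractor F A ->
  bounded_complete_trajectories F = trajectories_in F A.
Proof.
move=> cA attr; apply/seteqP; split=> gamma [Fg hg]; split=> //.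
  exact: bounded_complete_in_attractor Fg hg.
have [M hM] := compact_metric_bounded cA.
by exists M => _ _ [t _ <-] [t' _ <-]; exact: hM.
Qed.

Lemma attractor_bounded_complete F A : K1 F -> K2 F -> K3 F -> compact A ->
  global_attractor F A ->
  A = [set gamma 0 | gamma in bounded_complete_trajectories F] /\
  A = \bigcup_(t in [set: R]) [set gamma t | gamma in bounded_complete_trajectories F].
Proof.
move=> k1 k2 k3 cA attr; rewrite (bounded_complete_trajectoriesE cA attr).
have A0 x : A x -> exists2 gamma, trajectories_in F A gamma & gamma 0 = x.
  by move=> /(attractor_complete k1 k2 k3 cA attr)[gamma [? ? ?]]; exists gamma.
split; apply/seteqP; split=> x.
- by move=> /A0[gamma ? ?]; exists gamma.
- by move=> [gamma [_ Ag] <-].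
- by move=> /A0[gamma ? ?]; exists 0 => //; exists gamma.
- by move=> [t _ [gamma [_ Ag] <-]].
Qed.

Lemma uniform_cvg_near (S : set {nonneg R}) (phi : nat -> trajectory X)
    (psi : trajectory X) e : {uniform S, phi k @[k --> \oo] --> psi} -> 0 < e ->
  exists N, forall k, (N <= k)%N -> forall t, S t -> mdist (phi k t) (psi t) < e.
Proof.
move=> cv e0; have /cv[N _ hN] : nbhs (psi : {uniform` S -> X})
    [set h | forall t, S t -> mdist (h t) (psi t) < e].
  apply/uniform_nbhs; exists [set xy | ball xy.1 e xy.2]; split.
    exact: entourage_ball (PosNum e0).
  by move=> h hh t St; have := hh t St; rewrite /= ballEmdist /= metric_sym.
by exists N => k /hN.
Qed.

Lemma limsup_distX_near n (Xi : R -> 'I_n -> set X) :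
  ereal_sup (range (fun i => distX (Xi eta i) (Xi 0 i)))
    @[eta --> 0^'+] --> 0%E ->
  forall e, 0 < e -> exists2 h, 0 < h & forall eta i, 0 < eta <= h ->
    Xi eta i `<=` nhd e (Xi 0 i).
Proof.
move=> lim e e0; have := cvge0_near_lt _ lim e0.
move=> -[d /= d0 hd]; exists (d / 2); first by rewrite divr_gt0.
move=> eta i /andP[eta0 etad]; apply: distX_lt.
apply: le_lt_trans (hd eta _ eta0); first by apply: ereal_sup_ubound; exists i.
by rewrite /ball /= sub0r normrN gtr0_norm //; lra.
Qed.

Lemma limits_along_bounded (F : R -> set (trajectory X)) (eta : nat -> R) :
  (forall (eta : nat -> R) (gamma : nat -> trajectory X) (x0 : X),
     (forall k, 0 < eta k <= 1) -> eta k @[k --> \oo] --> 0 ->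
     (forall k, F (eta k) (gamma k)) ->
     gamma k 0%:nng @[k --> \oo] --> x0 ->
     exists (sigma : nat -> nat) (psi : trajectory X),
       [/\ increasing_seq sigma, F 0 psi
         & forall T : R, {uniform [set t : {nonneg R} | t%:num <= T],
             gamma (sigma k) @[k --> \oo] --> psi}]) ->
  (forall k, 0 < eta k <= 1) -> (forall k, eta k <= k.+1%:R^-1) ->
  limits_along bounded_windows (fun k => F (eta k)) (F 0).
Proof.
move=> lim eta01 etale rho phi x0 hrho Fphi /seq_limP phi0.
have [||s [psi [s_incr Fpsi cv]]] := lim (eta \o rho) phi x0 _ _ Fphi phi0.
- by move=> k; exact: eta01.
- apply/cvgrPdist_lt => e e0.
  have [N _ hN] := @near_infty_natSinv_lt R (PosNum e0).
  exists N => // k /hN /= ke; have /andP[ep _] := eta01 (rho k).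
  rewrite sub0r normrN gtr0_norm // (le_lt_trans (etale _)) //.
  by apply: le_lt_trans ke; rewrite lef_pV2 ?posrE // ler_nat ltnS.
exists s, psi; split=> // [k|S [M hM] e e0]; first exact: increasing_seq_ge.
have [N hN] := uniform_cvg_near (cv M) e0.
by exists N => k /hN{}hN t /hM tM; apply: hN; rewrite /= (le_trans (ler_norm _)).
Qed.

Definition perturbed_trajectories (F : R -> set (trajectory X)) (A : R -> set X)
    (eta : R) : set (R -> X) :=
  [set gamma | 0 < eta <= 1 /\ trajectories_in (F eta) (A eta) gamma].

(** A limit of trajectories in the attractors [A eta] lies in the compact
closure of their union; so it is bounded, and bounded complete trajectories of
[F 0] lie in [A 0]. *)
Lemma attractors_limit_system (F : R -> set (trajectory X)) (A : R -> set X)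
    n (Xi : 'I_n -> set X) r :
  (forall eta, 0 <= eta <= 1 ->
     forall phi, F eta phi -> trajectory_continuous phi) ->
  K2 (F 0) -> K3 (F 0) -> compact (A 0) -> global_attractor (F 0) (A 0) ->
  compact (closure (\bigcup_(eta in [set` `[0, 1]%R]) A eta)) ->
  (forall eta : nat -> R, (forall k, 0 < eta k <= 1) ->
     (forall k, eta k <= k.+1%:R^-1) ->
     limits_along bounded_windows (fun k => F (eta k)) (F 0)) ->
  0 < r ->
  (forall i j x, nhd (2 * r) (Xi i) x -> nhd (2 * r) (Xi j) x -> i = j) ->
  (forall i x, (forall e, 0 < e -> nhd e (Xi i) x) -> Xi i x) ->
  (forall i, Xi i `<=` A 0) -> (forall i, weakly_invariant (F 0) (Xi i)) ->
  (forall gamma, complete_trajectory (F 0) gamma -> (forall t, A 0 (gamma t)) ->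
     exists i j, distX [set gamma t] (Xi i) @[t --> -oo] --> 0%E /\
       distX [set gamma t] (Xi j) @[t --> +oo] --> 0%E) ->
  limit_system (trajectories_in (F 0) (A 0)) (perturbed_trajectories F A) Xi r.
Proof.
move=> Fcont k2 k3 cA0 attr0 cK lim r0 disj clXi XiA Xinv G1.
have I0 : 0 <= (0 : R) <= 1 by rewrite lexx ler01.
have Ipos (eta : R) : 0 < eta <= 1 -> 0 <= eta <= 1 by move=> /andP[/ltW-> ->].
split=> //.
- by move=> gamma [Fg _]; exact: complete_continuous (Fcont 0 I0) Fg.
- move=> eta gamma [/Ipos Ieta [Fg _]].
  exact: complete_continuous (Fcont eta Ieta) Fg.
- by move=> gamma c [Fg Ag]; split; [exact: complete_shift|].
- by move=> eta gamma c [Ieta [Fg Ag]]; split=> //; split; [exact: complete_shift|].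
- move=> gamma1 gamma2 [F1 A1] [F2 A2] e; split; first exact: complete_splice.
  by move=> t; rewrite /splice; case: ifP.
- move=> eta gamma heta Tg.
  have lim_eta : limits_along bounded_windows (fun k => F (eta k)) (F 0).
    by apply: lim => k; [have [] := Tg k|have /andP[] := heta k].
  have [||||s [zeta [hs Fz Kz cv]]] := limit_complete _ _ k2 lim_eta cK (gamma := gamma).
  + move=> S c [M hM]; exists (M + `|c|) => t /= /hM.
    by have := ler_normB (t + c) c; rewrite addrK; lra.
  + by move=> a; exists `|a| => t /= ->.
  + by move=> k; have [_ []] := Tg k.
  + move=> k t; apply: subset_closure; exists (eta k); last by have [_ []] := Tg k.
    by rewrite /= in_itv /=; have [/Ipos] := Tg k.
  exists s, zeta; split=> //; last first.
    move=> M; apply: cv; first by exists M.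
    by exists (- M) => t /=; rewrite ler_norml => /andP[].
  split=> //; apply: bounded_complete_in_attractor Fz _ => //.
  have [M hM] := compact_metric_bounded cK.
  by exists M => _ _ [t _ <-] [t' _ <-]; exact: hM.
- by move=> gamma [Fg Ag]; have [i [j [_ /cvg_pinfty_approaches]]] := G1 gamma Fg Ag; exists j.
- by move=> gamma [Fg Ag]; have [i [j [/cvg_ninfty_approaches]]] := G1 gamma Fg Ag; exists i.
- move=> i x /(Xinv i)[gamma [Fg Xg g0]]; exists gamma; split=> //.
  by split=> // t; apply: XiA.
Qed.

Lemma no_connection_cycle (F : set (trajectory X)) (A : set X) n (Xi : 'I_n -> set X) :
  dynamically_gradient F A Xi ->
  ~ exists k (p : 'I_k.+1 -> 'I_n),
    forall i, connection (trajectories_in F A) Xi (p i) (p (ordS i)).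
Proof.
move=> [_ _ nohom] [k [p /choice[g hg]]]; apply: nohom; exists k, p, g => i.
have [[Fg Ag] gi gj gt] := hg i; split=> //.
  exact/cvg_ninfty_approaches.
exact/cvg_pinfty_approaches.
Qed.

(** The bad trajectories are the members of homoclinic orbits.  A member that
comes close to [Xi 0 j] and does not leave its neighbourhood again tends to
[Xi eta j].  The next member of the cycle then comes from [Xi eta j], which is
close to [Xi 0 j], and it does leave: otherwise its range would be contained in
[V j] and thus in [Xi eta j], against the definition of a homoclinic orbit. *)
Lemma no_homoclinic_orbit (F : R -> set (trajectory X)) (A : R -> set X)
    n (Xi : R -> 'I_n -> set X) (V : 'I_n -> set X) eta_bar r :
  limit_system (trajectories_in (F 0) (A 0)) (perturbed_trajectories F A) (Xi 0) r ->
  ~ (exists f : nat -> 'I_n, forall k,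
       connection (trajectories_in (F 0) (A 0)) (Xi 0) (f k) (f k.+1)) ->
  (forall e, 0 < e -> exists2 h, 0 < h & forall eta i, 0 < eta <= h ->
     Xi eta i `<=` nhd e (Xi 0 i)) ->
  0 < eta_bar -> (forall i, nhd (2 * r) (Xi 0 i) `<=` V i) ->
  (forall i eta, 0 < eta <= 1 -> eta <= eta_bar ->
     maximal_weakly_invariant (F eta) (V i) (Xi eta i)) ->
  exists2 h, 0 < h & forall eta, 0 < eta <= 1 -> eta <= h ->
    ~ exists k (p : 'I_k.+1 -> 'I_n) g,
        homoclinic_orbit (F eta) (A eta) (Xi eta) p g.
Proof.
move=> ls nowalk near0 eta_bar0 rV maxV; have r0 := ls_gt0 ls.
pose member eta gamma := 0 < eta <= 1 /\ exists k (p : 'I_k.+1 -> 'I_n) g l,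
  homoclinic_orbit (F eta) (A eta) (Xi eta) p g /\ gamma = g l.
suff [h h0 nomember] : exists2 h, 0 < h &
    forall eta gamma, 0 < eta <= h -> ~ member eta gamma.
  exists h => // eta Ieta etah [k [p [g hom]]]; apply: (nomember eta (g ord0)).
    by have /andP[-> _] := Ieta.
  by split=> //; exists k, p, g, ord0.
apply: (no_bad_trajectory ls nowalk) => [eta gamma [Ieta [k [p [g [l [hom ->]]]]]]|e e0].
  by split=> //; have [Fg Ag _ _ _] := hom l.
have [|h h0 hh] := near0 (Num.min (e / 2) r); first by rewrite lt_min r0 divr_gt0.
exists (Num.min h eta_bar); first by rewrite lt_min h0.
move=> eta gamma j s /andP[eta0]; rewrite le_min => /andP[etah etabar].
move=> [Ieta [k [p [g [l [hom ->]]]]]] near_j.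
have near_eta i x : Xi eta i x -> nhd (e / 2) (Xi 0 i) x /\ nhd r (Xi 0 i) x.
  move=> xi; have {}xi : nhd (Num.min (e / 2) r) (Xi 0 i) x.
    by apply: (hh eta) xi; rewrite eta0.
  by split; apply: nhd_le xi; rewrite ge_min lexx ?orbT.
have [stays|leaves] := pselect (forall t, s <= t -> nhd r (Xi 0 j) (g l t)); last first.
  exists (g l), s; split=> //; first by split=> //; exists k, p, g, l.
  apply: contrapT => nt; apply: leaves => t st; apply: contrapT => nr.
  by apply: nt; exists t.
have jE : j = p (ordS l).
  have [_ _ _ /cvg_pinfty_approaches/(_ r r0)[M hM] _] := hom l.
  pose t := Num.max s (M + 1).
  apply: (@ls_disjoint _ _ _ _ _ _ _ ls _ _ (g l t)).
    apply: nhd_le (stays t _); first by lra.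
    by rewrite le_max lexx.
  have Mt : M < t by rewrite lt_max; apply/orP; right; lra.
  have -> : 2 * r = r + r by lra.
  by apply: nhd_nhd; apply: nhd_subset (hM t Mt) => x /near_eta[].
have [Fg Ag /cvg_ninfty_approaches from_j _ [t0 nt0]] := hom (ordS l).
have [t1 nt1] : exists t, ~ nhd r (Xi 0 j) (g (ordS l) t).
  apply: contrapT => /forallNP nt.
  have [_ _ Ximax] := maxV j eta Ieta etabar.
  apply: nt0; left; rewrite -jE.
  apply: (Ximax (range (g (ordS l)))); [exact: range_weakly_invariant| |by exists t0].
  move=> _ [t _ <-]; apply: rV; apply: (@nhd_le _ _ r); first by lra.
  exact: contrapT (nt t).
have e20 : 0 < e / 2 by lra.
have [M hM] := from_j _ e20.
pose t := Num.max (- t1) (M + 1).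
exists (g (ordS l)), (- t); split.
- by split=> //; exists k, p, g, (ordS l).
- have -> : e = e / 2 + e / 2 by lra.
  have Mt : M < t by rewrite lt_max; apply/orP; right; lra.
  by apply: nhd_nhd; rewrite jE; apply: nhd_subset (hM t Mt) => x /near_eta[].
- exists t1; split=> //; rewrite lerNl /t le_max lexx //.
Qed.

End AttractorTrajectories.

Theorem theorem12 (R : realType) (X : completeMetricType R)
  (F : R -> set (trajectory X)) (A : R -> set X)
  (n : nat) (Xi : R -> 'I_n -> set X)
  (F_continuous : forall eta, 0 <= eta <= 1 ->
     forall phi, F eta phi -> trajectory_continuous phi)
  (F_K : forall eta, 0 <= eta <= 1 ->
     [/\ K1 (F eta), K2 (F eta), K3 (F eta) & K4 (F eta)])
  (A_attractor : forall eta, 0 <= eta <= 1 ->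
     compact (A eta) /\ global_attractor (F eta) (A eta))
  (H1 : compact (closure (\bigcup_(eta in [set` `[0, 1]%R]) A eta)))
  (H2 : dynamically_gradient (F 0) (A 0) (Xi 0))
  (H3_isolated : forall eta, 0 <= eta <= 1 ->
     isolated_family_in (F eta) (A eta) (Xi eta))
  (H3_limit :
     ereal_sup (range (fun i => distX (Xi eta i) (Xi 0 i)))
       @[eta --> 0^'+] --> 0%E)
  (H4 : forall (eta : nat -> R) (gamma : nat -> trajectory X) (x0 : X),
     (forall k, 0 < eta k <= 1) -> eta k @[k --> \oo] --> 0 ->
     (forall k, F (eta k) (gamma k)) ->
     gamma k 0%:nng @[k --> \oo] --> x0 ->
     exists (sigma : nat -> nat) (psi : trajectory X),
       [/\ increasing_seq sigma, F 0 psi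
         & forall T : R, {uniform [set t : {nonneg R} | t%:num <= T],
             gamma (sigma k) @[k --> \oo] --> psi}])
  (H5 : exists2 eta_bar : R, 0 < eta_bar &
     exists2 V : 'I_n -> set X, (forall i, Xi 0 i `<=` interior (V i)) &
       forall i eta, 0 < eta <= 1 -> eta <= eta_bar ->
         maximal_weakly_invariant (F eta) (V i) (Xi eta i)) :
  exists2 eta0 : R, 0 < eta0 &
    forall eta, 0 <= eta <= 1 -> eta <= eta0 ->
      [/\ dynamically_gradient (F eta) (A eta) (Xi eta),
          A eta = [set gamma 0 | gamma in
                     bounded_complete_trajectories (F eta)]
        & A eta = \bigcup_(t in [set: R])
                    [set gamma t | gamma in
                       bounded_complete_trajectories (F eta)]].
Proof.
have I0 : 0 <= (0 : R) <= 1 by rewrite lexx ler01.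
have [k1 k2 k3 k4] := F_K 0 I0; have [cA0 attr0] := A_attractor 0 I0.
have [[[Xi0 [delta delta0 [dXi mXi]]] XiA] G1 G2] := H2.
have [eta_bar eta_bar0 [V XiV maxV]] := H5.
have clXi i x : (forall e, 0 < e -> nhd e (Xi 0 i) x) -> Xi 0 i x.
  exact: isolated_invariant_closed k2 k4 cA0 (XiA i) delta0 (mXi i).
(* The factor 2 is for limits of points of the [r]-neighbourhoods and for the
   sum of two distances below [r]. *)
have [r r0 hr] : exists2 r, 0 < r & (2 * r <= delta /\
    forall i, nhd (2 * r) (Xi 0 i) `<=` V i).
  have [|i|q q0 hq] := @uniform_radius R n (fun i q => nhd q (Xi 0 i) `<=` V i).
  - by move=> i q q' qq' h x /(nhd_le qq') /h.
  - exact: nhd_in_open cA0 (XiA i) (clXi i) (XiV i).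
  exists (Num.min q delta / 2); first by rewrite divr_gt0 // lt_min q0.
  rewrite mulrC divfK //; split; first by rewrite ge_min lexx orbT.
  by move=> i x /(nhd_le _) h; apply: (hq i); apply: h; rewrite ge_min lexx.
have [rdelta rV] := hr.
have disj i j x : nhd (2 * r) (Xi 0 i) x -> nhd (2 * r) (Xi 0 j) x -> i = j.
  move=> /(nhd_le rdelta); rewrite -thickeningE => xi.
  move=> /(nhd_le rdelta); rewrite -thickeningE => xj.
  have lt_absurd (a b : 'I_n) : thickening delta (Xi 0 a) x ->
      thickening delta (Xi 0 b) x -> (a < b)%N -> False.
    by move=> xa xb /(dXi a b) /seteqP[+ _] => /(_ x); apply.
  by apply: val_inj; case: (ltngtP i j) => // h; [case: (lt_absurd i j)|case: (lt_absurd j i)].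
have Xinv i : weakly_invariant (F 0) (Xi 0 i) by have [] := mXi i.
have ls : limit_system (trajectories_in (F 0) (A 0)) (perturbed_trajectories F A)
    (Xi 0) r.
  apply: attractors_limit_system => // eta; exact: limits_along_bounded.
have nocycle := no_connection_cycle H2.
have nowalk : ~ exists f : nat -> 'I_n, forall k,
    connection (trajectories_in (F 0) (A 0)) (Xi 0) (f k) (f k.+1).
  by case=> f /walk_cycle.
have nowalk_back : ~ exists f : nat -> 'I_n, forall k,
    connection (time_reversal (trajectories_in (F 0) (A 0))) (Xi 0) (f k) (f k.+1).
  case=> f hf; apply: nocycle; apply: backward_walk_cycle => k.
  exact: connection_reversal (hf k).
have [h1 h10 fwd] := eventually_near ls nowalk.
have [h2 h20 bwd] := eventually_near (limit_system_reversal ls) nowalk_back.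
have [h3 h30 nohom] :=
  no_homoclinic_orbit ls nowalk (limsup_distX_near H3_limit) eta_bar0 rV maxV.
pose eta0 := Num.min (Num.min h1 h2) (Num.min h3 eta_bar).
exists eta0; first by rewrite !lt_min h10 h20 h30.
move=> eta Ieta; rewrite !le_min => /andP[/andP[eta1 eta2] /andP[eta3 etabar]].
have [kk1 kk2 kk3 kk4] := F_K eta Ieta; have [cA attr] := A_attractor eta Ieta.
have [AE1 AE2] := attractor_bounded_complete kk1 kk2 kk3 cA attr.
split=> //.
have /andP[etage0 etale1] := Ieta.
have [eta0E|etapos] : eta = 0 \/ 0 < eta.
- by move: etage0; rewrite le_eqVlt => /orP[/eqP<-|]; [left|right].
- by rewrite eta0E.
have Ieta' : 0 < eta <= 1 by rewrite etapos.
have etah1 : 0 < eta <= h1 by rewrite etapos.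
have etah2 : 0 < eta <= h2 by rewrite etapos.
split; first exact: H3_isolated.
- move=> gamma Fg Ag.
  have [j fj] := fwd eta gamma etah1 (conj Ieta' (conj Fg Ag)).
  have Tg' : time_reversal (perturbed_trajectories F A eta) (fun t => gamma (- t)).
    rewrite /time_reversal /=.
    have -> : (fun t => gamma (- - t)) = gamma by apply/funext => t; rewrite opprK.
    by split.
  have [i bi] := bwd eta _ etah2 Tg'.
  exists i, j; split.
    apply/cvg_ninfty_approaches.
    have := @eventually_near_approaches _ _ _ _ _ (Xi eta i) _ r gamma true
      kk2 kk4 cA r0 (maxV i eta Ieta' etabar) (rV i) Fg Ag.
    rewrite expr1; under [X in approaches X]funext do rewrite mulN1r.
    by apply; have [s hs] := bi; exists s => t st; rewrite mulN1r; exact: hs.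
  apply/cvg_pinfty_approaches.
  have := @eventually_near_approaches _ _ _ _ _ (Xi eta j) _ r gamma false
    kk2 kk4 cA r0 (maxV j eta Ieta' etabar) (rV j) Fg Ag.
  rewrite expr0; under [X in approaches X]funext do rewrite mul1r.
  by apply; have [s hs] := fj; exists s => t st; rewrite mul1r; exact: hs.
- exact: nohom.
Qed.
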